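(* Let $k\geq 3$, let $a>b>0$ be integers, and let $u$ be an integer with $1\leq u\leq k$. Assume that it is not the case that simultaneously $u=2$, $a\equiv 3\pmod 6$ and $\frac{a}{2}<(k-2)b<\frac{2}{3}a$. Then a $3\text{-RP}(a^u b^{k-u})$ exists if and only if one of the following holds: (i) $u\geq 3$; (ii) $u=1$ and $a\leq (k-1)b$; (iii) $u=2$ and $a\leq 2(k-2)b$.
   Context: Write $[n]=\{1,\dots,n\}$. A latin cube of order $n$ is an $n\times n\times n$ array $C$ with entries from a set of $n$ symbols (by default $[n]$) such that each symbol occurs exactly once in each line, where a line is the set of $n$ cells obtained by fixing two of the three coordinates. A layer is the set of cells obtained by fixing one coordinate. A subcube of order $m$ of $C$ is an $m\times m\times m$ subarray of $C$ that is itself a latin cube of order $m$ (on some $m$ of the symbols). Two subcubes are disjoint if they share no layer (in any of the three directions) and no symbol. Given positive integers $h_1,\dots,h_k$ with $\sum_{i=1}^k h_i=n$, a $3\text{-RP}(h_1\dots h_k)$ (a 3-realization) is a latin cube of order $n$ with pairwise disjoint subcubes of orders $h_1,\dots,h_k$. The notation $3\text{-RP}(a^ub^{k-u})$ means that $u$ of the subcubes have order $a$ and $k-u$ have order $b$, so the latin cube has order $ua+(k-u)b$. *)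

(* Defs.v *)
From mathcomp Require Import all_boot.

Set Implicit Arguments.
Unset Strict Implicit.
Unset Printing Implicit Defensive.

(* An n x n x n array with entries in a set of n symbols; both the coordinates
   and the symbols are taken in {0, ..., n-1} instead of {1, ..., n}. *)
Definition array3 (n : nat) : Type := 'I_n -> 'I_n -> 'I_n -> 'I_n.

(* The subarray on X * Y * Z is a latin cube of order m on the symbol set S. *)
Definition latin_on (n m : nat) (C : array3 n) (X Y Z S : {set 'I_n}) : Prop :=
  [/\ [/\ #|X| = m, #|Y| = m, #|Z| = m & #|S| = m],
      forall x y z, x \in X -> y \in Y -> z \in Z -> C x y z \in S,
      forall s y z, s \in S -> y \in Y -> z \in Z ->
        exists! x, x \in X /\ C x y z = s,
      forall s x z, s \in S -> x \in X -> z \in Z ->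
        exists! y, y \in Y /\ C x y z = s
    & forall s x y, s \in S -> x \in X -> y \in Y ->
        exists! z, z \in Z /\ C x y z = s].

Definition latin_cube (n : nat) (C : array3 n) : Prop :=
  latin_on n C [set: 'I_n] [set: 'I_n] [set: 'I_n] [set: 'I_n].

Record block (n : nat) : Type := Block {
  coord1 : {set 'I_n};
  coord2 : {set 'I_n};
  coord3 : {set 'I_n};
  symbols : {set 'I_n}
}.

Definition subcube (n m : nat) (C : array3 n) (B : block n) : Prop :=
  latin_on m C (coord1 B) (coord2 B) (coord3 B) (symbols B).

(* Sharing no layer in direction i means having disjoint i-th coordinate sets. *)
Definition disjoint_blocks (n : nat) (B B' : block n) : bool :=
  [&& [disjoint coord1 B & coord1 B'], [disjoint coord2 B & coord2 B'],
      [disjoint coord3 B & coord3 B'] & [disjoint symbols B & symbols B']].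

Definition is_3RP (h : seq nat) (C : array3 (sumn h)) : Prop :=
  latin_cube C /\
  exists B : 'I_(size h) -> block (sumn h),
    (forall i : 'I_(size h), subcube (nth 0 h i) C (B i)) /\
    (forall i j : 'I_(size h), i != j -> disjoint_blocks (B i) (B j)).

Definition exists_3RP (h : seq nat) : Prop :=
  exists C : array3 (sumn h), is_3RP C.

(* Main.v *)
From HB Require Import structures.
From mathcomp Require Import all_boot all_algebra.
From mathcomp Require Import zify.
Require Import Defs.

Set Implicit Arguments.
Unset Strict Implicit.
Unset Printing Implicit Defensive.

(* Subcubes are the fibres of a map cls on an abstract finite point set, closed
   under the cube operation f.

   By Konig's theorem a regular bipartite graph splits into perfect matchings.
   Hence an array lev x y all of whose levels are regular is refined by a latin
   square F, and F z (f x y z) = F x y defines a latin cube whose subcubes are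
   read off lev. With v = k - u blocks of order b, this realizes a <= v * b
   directly. When v * b < a and u >= 3, a latin square of order u with a
   transversal, inflated by a, leaves room for u blocks of order a and one of
   order v * b, which is then replaced by a cube with v blocks of order b.

   The same replacement leaves, for u = 2, two blocks of order a and one of order
   c = (k - 2) * b with c < a <= 2c. That cube is glued from an (a - c)-plex of a
   latin square of order a; the plex is a union of difference classes in an
   abelian group, or in the double of one if a is twice an odd number up to
   powers of 4, except when a = 2c with c odd, where a cube of order 5 is
   inflated by c.

   Conversely, a cube outside a proper subcube must have room for its symbols,
   and for u = 2 double counting in a layer of one large block gives a <= 2c. *)

(** * Regular bipartite graphs *)

Section Hall.
Variable T : finType.
Implicit Types (E : rel T) (A X : {set T}).

(** A relation on [T] is read as a bipartite graph between two copies of [T]. *)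
Definition nbhd E A := [set y | [exists x in A, E x y]].

(** Induction on the size of [X], split by whether some nonempty proper subset is tight, that is,
    has no more neighbours than elements. *)
Lemma hall E X : (forall A, A \subset X -> #|A| <= #|nbhd E A|) ->
  exists f : T -> T, {in X &, injective f} /\ {in X, forall x, E x (f x)}.
Proof.
have [n] := ubnP #|X|; elim: n => // n IHn in X E * => /ltnSE leXn hallX.
have [X0|[x0 x0X]] := set_0Vmem X.
  by exists id; split=> [x y|x]; rewrite X0 inE.
case: (boolP [exists A : {set T}, [&& A \proper X, A != set0 & #|nbhd E A| <= #|A|]]).
  case/existsP=> A /and3P[pAX A0 tA]; have sAX := proper_sub pAX.
  have [f [fI fE]] : exists f : T -> T, {in A &, injective f} /\ {in A, forall x, E x (f x)}.
    apply: IHn => [|C sCA]; first exact: leq_trans (proper_card pAX) leXn.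
    exact: hallX (subset_trans sCA sAX).
  (* The rest is matched outside the neighbourhood of [A]. Hall's condition for [C] there follows
     from that for [A :|: C], as [A] accounts for at most [#|A|] neighbours. *)
  pose E' x y := E x y && (y \notin nbhd E A).
  have [g [gI gE]] : exists g : T -> T,
      {in X :\: A &, injective g} /\ {in X :\: A, forall x, E' x (g x)}.
    apply: IHn => [|C sCX].
      apply: leq_trans leXn; apply: proper_card; apply/properP; split.
        exact: subsetDl.
      have /set0Pn[x xA] := A0; exists x; first exact: (subsetP sAX).
      by rewrite inE xA.
    have dCA : [disjoint A & C].
      rewrite disjoint_sym disjoints_subset; apply/subsetP=> x /(subsetP sCX).
      by rewrite !inE => /andP[].
    have sAC : A :|: C \subset X.
      by rewrite subUset sAX (subset_trans sCX) ?subsetDl.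
    have := hallX _ sAC; rewrite cardsU (_ : A :&: C = set0) ?cards0 ?subn0; last first.
      by apply/eqP; rewrite setI_eq0.
    have sub : nbhd E (A :|: C) \subset nbhd E A :|: nbhd E' C.
      apply/subsetP=> y; rewrite !inE => /existsP[x /andP[]]; rewrite inE.
      case: (boolP [exists x0 in A, E x0 y]) => //= nA /orP[xA Exy|xC Exy].
        by case/negP: nA; apply/existsP; exists x; rewrite xA.
      by apply/existsP; exists x; rewrite xC /E' Exy inE.
    move=> h; have {}sub := subset_leq_card sub.
    have := leq_trans (leq_trans h sub) (leq_card_setU _ _).
    by move/leq_trans/(_ (leq_add tA (leqnn _))); rewrite leq_add2l.
  have {}gE x : x \in X -> x \notin A -> E x (g x) /\ g x \notin nbhd E A.
    by move=> xX xA; apply/andP/gE; rewrite inE xA.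
  exists (fun x => if x \in A then f x else g x); split=> [x y xX yX|x xX]; last first.
    case: ifPn => xA; first exact: fE.
    by case: (gE x xX xA).
  have fN z : z \in A -> f z \in nbhd E A.
    by move=> zA; rewrite inE; apply/existsP; exists z; rewrite zA fE.
  have gN z : z \in X -> z \notin A -> g z \notin nbhd E A.
    by move=> zX zA; case: (gE z zX zA).
  case: ifPn => xA; case: ifPn => yA.
  - exact: fI.
  - by move=> fg; have := gN y yX yA; rewrite -fg fN.
  - by move=> fg; have := gN x xX xA; rewrite fg fN.
  - by apply: gI; rewrite inE ?xA ?yA.
(* Now every nonempty proper subset has a neighbour to spare, so [x0] may take any neighbour
   [y0]. *)
rewrite negb_exists => /forallP tight.
have [y0 Exy0] : exists y, E x0 y.
  have := hallX [set x0]; rewrite sub1set x0X cards1 => /(_ isT).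
  rewrite card_gt0 => /set0Pn[y]; rewrite inE => /existsP[x /andP[]].
  by rewrite inE => /eqP-> ?; exists y.
pose E' x y := E x y && (y != y0).
have [g [gI gE]] : exists g : T -> T,
    {in X :\ x0 &, injective g} /\ {in X :\ x0, forall x, E' x (g x)}.
  apply: IHn => [|A sAX]; first by move: leXn; rewrite (cardsD1 x0 X) x0X.
  have [->|A0] := eqVneq A set0; first by rewrite cards0.
  have pA : A \proper X by apply: sub_proper_trans sAX _; rewrite properD1.
  have := tight A; rewrite pA A0 /= -ltnNge => ltA.
  have : nbhd E A :\ y0 \subset nbhd E' A.
    apply/subsetP=> y; rewrite !inE => /andP[ny /existsP[x /andP[xA Exy]]].
    by apply/existsP; exists x; rewrite xA /E' Exy.
  move/subset_leq_card/(leq_trans _); apply; rewrite -ltnS.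
  apply: leq_trans ltA _; rewrite (cardsD1 y0).
  by case: (_ \in _); rewrite ?add1n ?add0n ?leqnSn.
have {}gE x : x \in X -> x != x0 -> E x (g x) /\ g x != y0.
  by move=> xX nx; apply/andP/gE; rewrite !inE nx.
exists (fun x => if x == x0 then y0 else g x); split=> [x y xX yX|x xX]; last first.
  case: eqP => [->//|/eqP nx].
  by case: (gE x xX nx).
have gN z : z \in X -> z != x0 -> g z != y0.
  by move=> zX nz; case: (gE z zX nz).
case: (eqVneq x x0) => [->|nx]; case: (eqVneq y x0) => [->|ny] //.
- by move=> e; have := gN y yX ny; rewrite -e eqxx.
- by move=> e; have := gN x xX nx; rewrite e eqxx.
- by apply: gI; rewrite !inE ?nx ?ny.
Qed.

Definition regular E r := 
  (forall x, #|[set y | E x y]| = r) /\ (forall y, #|[set x | E x y]| = r).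

(** The [#|A| * r] edges leaving [A] all end in its neighbourhood, which receives [r] per vertex;
    this is Hall's condition. *)
Lemma regular_matching E r : 0 < r -> regular E r ->
  exists f : T -> T, injective f /\ forall x, E x (f x).
Proof.
move=> r0 [rowE colE]; have [|f [fI fE]] := @hall E setT.
  move=> A _; rewrite -(leq_pmul2r r0).
  pose D := [set p : T * T | (p.1 \in A) && E p.1 p.2].
  have -> : #|A| * r = #|D|.
    rewrite -sum_nat_const -(eq_bigr _ (fun x _ => rowE x)).
    rewrite -sum1_card (eq_bigr (fun x => \sum_(y | E x y) 1)); last first.
      by move=> x _; rewrite sum1_card cardsE.
    by rewrite pair_big_dep; apply: eq_bigl => -[x y]; rewrite inE.
  have -> : #|nbhd E A| * r = #|[set p : T * T | (p.2 \in nbhd E A) && E p.1 p.2]|.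
    rewrite -sum_nat_const -(eq_bigr _ (fun x _ => colE x)).
    rewrite -[RHS]sum1_card (eq_bigr (fun y => \sum_(x | E x y) 1)); last first.
      by move=> x _; rewrite sum1_card cardsE.
    rewrite pair_big_dep [RHS](reindex (fun p => (p.2, p.1))) /=.
      by apply: eq_bigl => -[x y]; rewrite [in RHS]inE.
    by exists (fun p => (p.2, p.1)) => -[].
  apply/subset_leq_card/subsetP=> -[x y]; rewrite !inE /= => /andP[xA Exy].
  by rewrite Exy andbT; apply/existsP; exists x; rewrite xA.
by exists f; split=> [x y|x]; [apply: fI | apply: fE]; rewrite inE.
Qed.

Lemma regular_remove E r : regular E r.+1 ->
  exists f : T -> T, [/\ injective f, forall x, E x (f x) &
    regular (fun x y => E x y && (y != f x)) r].
Proof.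
move=> regE; have [f [fI fE]] := regular_matching (ltn0Sn r) regE.
case: regE => rowE colE; exists f; split=> //; split=> [x|y].
  have := rowE x; rewrite (cardsD1 (f x)) inE fE add1n => -[<-].
  by congr #|pred_of_set _|; apply/setP=> y; rewrite !inE andbC.
have /(@codomP T T f)[x yx] : y \in codom f by apply: inj_card_onto.
have := colE y; rewrite (cardsD1 x) inE {1}yx fE add1n => -[<-].
congr #|pred_of_set _|; apply/setP=> x'; rewrite !inE andbC yx.
by rewrite (inj_eq fI) eq_sym.
Qed.

(** Perfect matchings are removed until degree [m] is left. *)
Lemma regular_sub E r m : regular E r -> m <= r ->
  exists E' : rel T, (forall x y, E' x y -> E x y) /\ regular E' m.
Proof.
move=> regE /subnKC er; move: (r - m) er => k; move: r E regE.
elim: k => [|k IHk] r E regE er; first by exists E; rewrite -er addn0 in regE *.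
rewrite -er addnS in regE; have [f [_ _ regf]] := regular_remove regE.
have [E' [sub regE']] := IHk _ _ regf erefl; exists E'; split=> // x y /sub.
by case/andP.
Qed.

(** A proper edge colouring in which each of the [r] colours is a perfect matching. *)
Definition coloring E r (c : T -> T -> nat) :=
  [/\ forall x y, E x y -> c x y < r,
      forall x i, i < r -> exists2 y, E x y & c x y = i,
      forall y i, i < r -> exists2 x, E x y & c x y = i,
      forall x y y', E x y -> E x y' -> c x y = c x y' -> y = y' &
      forall x x' y, E x y -> E x' y -> c x y = c x' y -> x = x'].

(** Each matching removed becomes a colour class, the first one with the largest colour. *)
Lemma konig E r : regular E r -> exists c, coloring E r c.
Proof.
elim: r E => [|r IHr] E regE; first exists (fun _ _ => 0).
  case: regE => rowE colE; have nE x y : E x y = false.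
    by have /eqP := rowE x; rewrite cards_eq0 => /eqP/setP/(_ y); rewrite !inE.
  by split=> [x y|||x y y'|x x' y] //; rewrite nE.
have [f [fI fE regf]] := regular_remove regE.
have [c [c1 c2 c3 c4 c5]] := IHr _ regf.
exists (fun x y => if y == f x then r else c x y); split.
- by move=> x y Exy; case: ifPn => // nf; rewrite ltnS ltnW // c1 // Exy.
- move=> x i; rewrite ltnS leq_eqVlt => /orP[/eqP->|ltir].
    by exists (f x); rewrite ?eqxx.
  have [y /andP[Exy nf] cy] := c2 x i ltir; exists y => //.
  by rewrite (negbTE nf).
- move=> y i; rewrite ltnS leq_eqVlt => /orP[/eqP->|ltir].
    have /(@codomP T T f)[x yx] : y \in codom f by apply: inj_card_onto.
    by exists x; rewrite yx ?eqxx.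
  have [x /andP[Exy nf] cy] := c3 y i ltir; exists x => //.
  by rewrite (negbTE nf).
- move=> x y y' Exy Exy'.
  case: (eqVneq y (f x)) => [->|nf]; case: (eqVneq y' (f x)) => [->|nf'] //.
  + by move=> e; have := @c1 x y'; rewrite Exy' nf' -e ltnn => /(_ isT).
  + by move=> e; have := @c1 x y; rewrite Exy nf e ltnn => /(_ isT).
  + by apply: c4; rewrite ?Exy ?Exy'.
- move=> x x' y Exy Exy'.
  case: (eqVneq y (f x)) => [yf|nf]; case: (eqVneq y (f x')) => [yf'|nf'].
  + by move=> _; apply: fI; rewrite -yf.
  + by move=> e; have := @c1 x' y; rewrite Exy' nf' -e ltnn => /(_ isT).
  + by move=> e; have := @c1 x y; rewrite Exy nf e ltnn => /(_ isT).
  + by apply: c5; rewrite ?Exy ?Exy'.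
Qed.

End Hall.

(** * Realizations from maps on a finite set *)

Definition latin3 (T : eqType) (f : T -> T -> T -> T) :=
  [/\ forall y z, injective (fun x => f x y z),
      forall x z, injective (fun y => f x y z)
    & forall x y, injective (f x y)].

(** Each fibre of [cls] is closed under [f], hence a subcube with the same index set in all
    directions and for the symbols. *)
Definition preserves (T K : eqType) (cls : T -> K) (f : T -> T -> T -> T) :=
  forall x y z, cls x = cls y -> cls y = cls z -> cls (f x y z) = cls x.

(** Injective maps of a finite set are onto, so [latin3] yields the exactly-once conditions, also on
    closed subsets. *)
Lemma inj_in_exists_unique (T : finType) (X : {set T}) (g : T -> T) :
  injective g -> {in X, forall x, g x \in X} ->
  forall s, s \in X -> exists! x, x \in X /\ g x = s.
Proof.
move=> gI gX s sX.
have : s \in g @: X.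
  rewrite (_ : g @: X = X) //; apply/eqP; rewrite eqEcard card_imset // leqnn andbT.
  by apply/subsetP=> _ /imsetP[x xX ->]; apply: gX.
by case/imsetP=> x xX ->; exists x; split=> // x' [_ /gI].
Qed.

Lemma latin3_on n (C : array3 n) (X : {set 'I_n}) :
  latin3 C -> (forall x y z, x \in X -> y \in X -> z \in X -> C x y z \in X) ->
  latin_on #|X| C X X X X.
Proof.
case=> C1 C2 C3 CX; split=> // s x y sX xX yX.
- by apply: (inj_in_exists_unique (C1 x y)) => // z zX; apply: CX.
- by apply: (inj_in_exists_unique (C2 x y)) => // z zX; apply: CX.
- by apply: (inj_in_exists_unique (C3 x y)) => // z zX; apply: CX.
Qed.

(** Transport along an enumeration of [T]; distinct fibres are disjoint, so the subcubes share
    neither layers nor symbols. *)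
Lemma realize (h : seq nat) (T : finType) (f : T -> T -> T -> T)
    (cls : T -> 'I_(size h)) :
  latin3 f -> preserves cls f ->
  (forall i, #|[set x | cls x == i]| = nth 0 h i) -> exists_3RP h.
Proof.
case=> f1 f2 f3 fcls szcls.
have eT : #|T| = sumn h.
  rewrite sumnE (big_nth 0) big_mkord -sum1_card (partition_big cls predT) //=.
  apply: eq_bigr => i _; rewrite -szcls -sum1_card.
  by apply: eq_bigl => x; rewrite inE.
pose e x : 'I_(sumn h) := cast_ord eT (enum_rank x).
pose e' i : T := enum_val (cast_ord (esym eT) i).
have eK : cancel e e' by move=> x; rewrite /e' /e cast_ordK enum_rankK.
have e'K : cancel e' e by move=> x; rewrite /e' /e enum_valK cast_ordKV.
have eI := can_inj eK; have e'I := can_inj e'K.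
pose C : array3 (sumn h) := fun x y z => e (f (e' x) (e' y) (e' z)).
have latC : latin3 C.
  by split=> x y z z' /eI; [move/f1|move/f2|move/f3]; move/e'I.
exists C; split.
  by rewrite /latin_cube -[X in latin_on X](card_ord (sumn h)) -cardsT; apply: latin3_on.
pose X i := [set k | cls (e' k) == i].
exists (fun i => Block (X i) (X i) (X i) (X i)); split=> [i|i j nij].
  have <- : #|X i| = nth 0 h i.
    rewrite -szcls -(card_imset _ e'I); congr #|pred_of_set _|; apply/setP=> x.
    rewrite inE; apply/imsetP/idP => [[k]|xi]; first by rewrite inE => ? ->.
    by exists (e x); rewrite ?inE eK.
  apply: latin3_on => // x y z; rewrite !inE => /eqP xi /eqP yi /eqP zi.
  by rewrite eK fcls ?xi ?yi ?zi.
have dX : [disjoint X i & X j].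
  rewrite -setI_eq0; apply/eqP/setP=> k; rewrite !inE.
  by case: eqP => // ->; apply/negbTE.
by rewrite /disjoint_blocks /= dX.
Qed.

Lemma realize_two (u v a b : nat) (T K1 K2 : finType) (f : T -> T -> T -> T)
    (cls : T -> K1 + K2) :
  #|K1| = u -> #|K2| = v -> latin3 f -> preserves cls f ->
  (forall i, #|[set x | cls x == inl i]| = a) ->
  (forall j, #|[set x | cls x == inr j]| = b) ->
  exists_3RP (nseq u a ++ nseq v b).
Proof.
move=> K1u K2v latf fcls sza szb.
have szh : u + v = size (nseq u a ++ nseq v b) by rewrite size_cat !size_nseq.
pose r (k : K1 + K2) : 'I_u + 'I_v := match k with
  | inl i => inl (cast_ord K1u (enum_rank i))
  | inr j => inr (cast_ord K2v (enum_rank j)) end.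
have rI : injective r by case=> k [] k' // [/ord_inj/enum_rank_inj->].
pose g k := cast_ord szh (unsplit (r k)).
have gI : injective g.
  by move=> k k' /cast_ord_inj/(can_inj (@unsplitK _ _))/rI.
apply: (@realize _ _ f (g \o cls)) => // [x y z /gI exy /gI eyz|i].
  by congr g; apply: fcls.
have [k ->] : exists k, i = g k.
  pose s := split (cast_ord (esym szh) i).
  have [k rk] : exists k, r k = s.
    case: s => j.
      exists (inl (enum_val (cast_ord (esym K1u) j))).
      by rewrite /= enum_valK cast_ordKV.
    exists (inr (enum_val (cast_ord (esym K2v) j))).
    by rewrite /= enum_valK cast_ordKV.
  by exists k; rewrite /g rk splitK cast_ordKV.
transitivity #|[set x | cls x == k]|.
  by congr #|pred_of_set _|; apply/setP=> x; rewrite !inE (inj_eq gI).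
rewrite nth_cat size_nseq; case: k => k /=; rewrite ?sza ?szb.
  have lt_k : enum_rank k < u by rewrite -K1u.
  by rewrite lt_k nth_nseq lt_k.
have lt_k : enum_rank k < v by rewrite -K2v.
by rewrite ltnNge leq_addr /= addKn nth_nseq lt_k.
Qed.

(** * Latin cubes with prescribed levels *)

Lemma latin3_of_rel (T : finType) (Q : T -> T -> T -> T -> Prop) :
  (forall x y z, exists s, Q x y z s) ->
  (forall x x' y z s, Q x y z s -> Q x' y z s -> x = x') ->
  (forall x y y' z s, Q x y z s -> Q x y' z s -> y = y') ->
  (forall x y z z' s, Q x y z s -> Q x y z' s -> z = z') ->
  exists f, latin3 f /\ forall x y z, Q x y z (f x y z).
Proof.
move=> ex Q1 Q2 Q3.
have [f fQ] := fin_all_exists (fun p : T * T * T => ex p.1.1 p.1.2 p.2).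
have {}fQ x y z : Q x y z (f (x, y, z)) by apply: (fQ (x, y, z)).
exists (fun x y z => f (x, y, z)); split=> //; split=> [y z x x'|x z y y'|x y z z'] ff.
- by apply: Q1 (fQ x y z) _; rewrite ff; apply: fQ.
- by apply: Q2 (fQ x y z) _; rewrite ff; apply: fQ.
- by apply: Q3 (fQ x y z) _; rewrite ff; apply: fQ.
Qed.

(* A latin square F whose level (x, y) |-> lev x y is prescribed exists by
   Konig's theorem; f is then determined by F z (f x y z) = F x y. *)
Lemma composite (T L : finType) (lev : T -> T -> L) (r : L -> nat) :
  (forall l, regular (fun x y => lev x y == l) (r l)) ->
  exists f, latin3 f /\ forall x y z, lev z (f x y z) = lev x y.
Proof.
move=> reg; have [c cP] := fin_all_exists (fun l => konig (reg l)).
pose F x y := (lev x y, c (lev x y) x y).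
have [||||f [latf fQ]] := @latin3_of_rel T (fun x y z s => F z s = F x y).
- move=> x y z; have [c1 c2 _ _ _] := cP (lev x y).
  have [s /eqP zs cs] := c2 z _ (c1 x y (eqxx _)).
  by exists s; rewrite /F zs cs.
- move=> x x' y z s -> [e1 e2]; have [_ _ _ _ c5] := cP (lev x y).
  by apply: (c5 x x' y); rewrite ?e1 // -e2 e1.
- move=> x y y' z s -> [e1 e2]; have [_ _ _ c4 _] := cP (lev x y).
  by apply: (c4 x y y'); rewrite ?e1 // -e2 e1.
- move=> x y z z' s [e1 e2] [e3 e4]; have [_ _ _ _ c5] := cP (lev x y).
  by apply: (c5 z z' s); rewrite ?e1 ?e3 //; move: e2 e4; rewrite e1 e3 => -> ->.
by exists f; split=> // x y z; have [] := fQ x y z.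
Qed.

(** * Two large blocks *)

Lemma coloring_flip (T : finType) (E E' : rel T) r c :
  (forall x y, E' x y = E y x) -> coloring E r c ->
  coloring E' r (fun x y => c y x).
Proof.
move=> eE [c1 c2 c3 c4 c5]; split.
- by move=> x y; rewrite eE; apply: c1.
- by move=> x i /(c3 x)[y]; rewrite -eE; exists y.
- by move=> x i /(c2 x)[y]; rewrite -eE; exists y.
- by move=> x y y'; rewrite !eE; apply: c5.
- by move=> x y y'; rewrite !eE; apply: c4.
Qed.

Definition lrow (I : finType) (M : I -> I -> I) (K : rel I) x j :=
  [exists s, K x s && (M x s == j)].

(* A cube with two subcubes of order #|I| and one of order b lives on the points
   (bool * I) + 'I_b. Its data: a latin square fM on I with a (#|I| - b)-plex fK;
   a partial square fU, off fK, in which j occurs in the rows where it occurs in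
   fK and in the columns where fu j occurs in fK; b-colourings fnu, fnu', fc, fW,
   whose colours are the points of the third block; a latin square fL on 'I_b. *)
Record frame (I : finType) (b : nat) := Frame {
  fM : I -> I -> I;
  fK : rel I;
  fU : I -> I -> option I;
  fu : I -> I;
  fu' : I -> I;
  fnu : I -> I -> nat;
  fnu' : I -> I -> nat;
  fc : bool -> I -> I -> nat;
  fW : bool * I -> bool * I -> nat;
  fL : 'I_b -> 'I_b -> 'I_b
}.

Section Frame.
Variables (I : finType) (b : nat).
Implicit Types (F : frame I b) (x y z s j l m : I) (p q : bool).

Definition rows F := lrow (fM F) (fK F).
Definition cols F := lrow (fun s x => fM F x s) (fun s x => fK F x s).

(** In [Q], for points in the copies [t1] to [t4], [p] is [t1 (+) t4] and [q] is [t1 (+) t2]. A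
    label [l] occurs in row [x] exactly if [rows F x l] when [p] holds, and exactly if not when only
    [q] holds. In both cases the third block supplies the symbol if [~~ rows F x l]. *)
Definition lab F p q x s : option I :=
  if p then if q then fU F x s else if fK F x s then Some (fM F x s) else None
  else if q then if fK F x s then None else Some (fM F x s) else None.

Arguments lab : simpl never.

(** By [U_cols], column occurrences of [l] in [fU] are governed by [fu F l]; labels come from [fU]
    exactly when [p] and [q] hold. *)
Definition shift F p q := if p && q then fu F else id.

(** The pairs that carry no label for either value of [q]; through [fW] and [fL] such a pair is
    joined to two points of the third block. *)
Definition spare F (g h : bool * I) :=
  if g.1 == h.1 then fK F g.2 h.2 else ~~ fK F g.2 h.2 && (fU F g.2 h.2 == None).

Record valid F : Prop := Valid {
  M_row : forall x, injective (fM F x);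
  M_col : forall s, injective (fM F ^~ s);
  U_row : forall x s s' j, fU F x s = Some j -> fU F x s' = Some j -> s = s';
  U_col : forall x x' s j, fU F x s = Some j -> fU F x' s = Some j -> x = x';
  U_rows : forall x j, rows F x j <-> exists s, fU F x s = Some j;
  U_cols : forall s j, cols F s (fu F j) <-> exists x, fU F x s = Some j;
  U_K : forall x s j, fU F x s = Some j -> fK F x s = false;
  uK : cancel (fu F) (fu' F);
  uK' : cancel (fu' F) (fu F);
  nu_col : coloring (fun x j => ~~ rows F x j) b (fnu F);
  nu'_col : coloring (fun s j => ~~ cols F s j) b (fnu' F);
  c_col : forall q, coloring (fun x s => lab F true q x s == None) b (fc F q);
  W_col : coloring (spare F) b (fW F);
  L_row : forall t, injective (fL F t);
  L_col : forall t, injective (fL F ^~ t)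
}.

(** For [p] false and [q] true, the clause on [fK] removes the pairs of cells with equal symbol that
    both lie off the plex; there the third block supplies the symbol. *)
Definition linked F p q x s y z :=
  if p then lab F true q x s = lab F true q y z /\
            (lab F true q x s = None -> fc F q x s = fc F q y z)
  else fM F x s = fM F y z /\ (q -> fK F x s || fK F y z).

Definition pt : finType := ((bool * I) + 'I_b)%type.

(* Q F x y z s: the entry of the cube at (x, y, z) is s. The invariance of Q under
   (x, y, z, s) |-> (y, x, s, z) and, up to dualising F, under reversal reduces
   unique solvability in each of the four arguments to one of them. *)
Definition Q F (x y z s : pt) : Prop :=
  match x, y, z, s with
  | inl (t1, x), inl (t2, y), inl (t3, z), inl (t4, s) =>
      t1 (+) t2 = t3 (+) t4 /\ linked F (t1 (+) t4) (t1 (+) t2) x s y z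
  | inl (t1, x), inl (t2, y), inl (t3, z), inr e4 =>
      exists l, [/\ lab F (t2 (+) t3) (t1 (+) t2) y z = Some l,
                    ~~ rows F x l & fnu F x l = e4]
  | inl (t1, x), inl (t2, y), inr e3, inl (t4, s) =>
      exists l, [/\ lab F (t1 (+) t4) (t1 (+) t2) x s = Some l,
                    ~~ rows F y l & fnu F y l = e3]
  | inl (t1, x), inr e2, inl (t3, z), inl (t4, s) =>
      exists l, [/\ lab F (t1 (+) t4) (t3 (+) t4) x s = Some l,
                    ~~ cols F z (shift F (t1 (+) t4) (t3 (+) t4) l) &
                    fnu' F z (shift F (t1 (+) t4) (t3 (+) t4) l) = e2]
  | inr e1, inl (t2, y), inl (t3, z), inl (t4, s) =>
      exists l, [/\ lab F (t2 (+) t3) (t3 (+) t4) y z = Some l,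
                    ~~ cols F s (shift F (t2 (+) t3) (t3 (+) t4) l) &
                    fnu' F s (shift F (t2 (+) t3) (t3 (+) t4) l) = e1]
  | inl (t1, x), inl (t2, y), inr e3, inr e4 =>
      t1 = t2 /\ exists l, [/\ ~~ rows F x l, ~~ rows F y l, fnu F x l = e4 & fnu F y l = e3]
  | inl (t1, x), inr e2, inl (t3, z), inr e4 =>
      t1 = t3 /\ exists l, [/\ ~~ rows F x l, ~~ cols F z (fu F l),
                               fnu F x l = e4 & fnu' F z (fu F l) = e2]
  | inr e1, inl (t2, y), inr e3, inl (t4, s) =>
      t2 = t4 /\ exists l, [/\ ~~ rows F y l, ~~ cols F s (fu F l),
                               fnu F y l = e3 & fnu' F s (fu F l) = e1]
  | inr e1, inr e2, inl (t3, z), inl (t4, s) =>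
      t3 = t4 /\ exists l, [/\ ~~ cols F z l, ~~ cols F s l, fnu' F z l = e2 & fnu' F s l = e1]
  | inl g, inr e2, inr e3, inl h => spare F g h /\ fW F g h = fL F e2 e3
  | inr e1, inl g, inl h, inr e4 => spare F g h /\ fW F g h = fL F e1 e4
  | inr e1, inr e2, inr e3, inr e4 => fL F e1 e4 = fL F e2 e3
  | _, _, _, _ => False
  end.

Lemma Q_swap F (x y z s : pt) : Q F x y z s -> Q F y x s z.
Proof.
case: x y z s => [[t1 x]|e1] [[t2 y]|e2] [[t3 z]|e3] [[t4 s]|e4] //=.
- case=> et link; rewrite (addbC t2) (addbC t4) et; split=> //.
  have -> : t2 (+) t3 = t1 (+) t4 by case: t1 t2 t3 t4 et {link} => [] [] [] [].
  move: link; rewrite -et /linked; case: ifP => _ [e1 e2]; split=> //.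
    by rewrite -e1 => /e2.
  by move=> /e2; rewrite orbC.
- by rewrite (addbC t2 t1).
- by rewrite (addbC t2 t1).
- by case=> -> [l [? ? ? ?]]; split=> //; exists l.
- by rewrite (addbC t4 t3).
- by rewrite (addbC t4 t3).
- by case=> -> [l [? ? ? ?]]; split=> //; exists l.
Qed.

(** Rows and columns change places. The labels of [fU] are renamed by [fu], so that [U_rows] and
    [U_cols] change places as well. *)
Definition dual F : frame I b :=
  Frame (fun s x => fM F x s) (fun s x => fK F x s)
    (fun s x => omap (fu F) (fU F x s)) (fu' F) (fu F)
    (fnu' F) (fnu F) (fun q s x => fc F q x s) (fun h g => fW F g h)
    (fun e e' => fL F e' e).

Lemma lab_dual F p q x s :
  lab (dual F) p q s x = omap (shift F p q) (lab F p q x s).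
Proof. by rewrite /lab /shift; case: p; case: q => //=; case: ifP. Qed.

Lemma omap_None (T T' : Type) (f : T -> T') a : omap f a = None -> a = None.
Proof. by case: a. Qed.

Lemma spare_dual F g h : spare (dual F) h g = spare F g h.
Proof.
rewrite /spare eq_sym /=; case: ifP => // _; congr (_ && _).
by case: (fU F _ _).
Qed.

Lemma valid_dual F : valid F -> valid (dual F).
Proof.
case=> Mr Mc Ur Uc Us Us' UK uK uK' nu nu' c W Lr Lc; split => //.
- move=> s x x' j /=; case e: (fU F x s) => [l|] //= [<-].
  case e': (fU F x' s) => [l'|] //= [/(can_inj uK) el].
  by rewrite el in e'; apply: Uc e e'.
- move=> s s' x j /=; case e: (fU F x s) => [l|] //= [<-].
  case e': (fU F x s') => [l'|] //= [/(can_inj uK) el].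
  by rewrite el in e'; apply: Ur e e'.
- move=> s j; rewrite -{1}(uK' j); apply: iff_trans (Us' s (fu' F j)) _.
  split=> -[x] /=; first by move=> e; exists x; rewrite /= e /= uK'.
  by case e: (fU F x s) => [l|] //= [<-]; exists x; rewrite uK.
- move=> x j; apply: iff_trans (Us x (fu' F j)) _.
  split=> -[s] /=; first by move=> e; exists s; rewrite /= e /= uK'.
  by case e: (fU F x s) => [l|] //= [<-]; exists s; rewrite uK.
- by move=> s x j /=; case e: (fU F x s) => [l|] //= _; apply: UK e.
- move=> q; apply: coloring_flip (c q) => x s; rewrite lab_dual.
  by case: (lab _ _ _ _ _).
- by apply: coloring_flip W => g h; rewrite spare_dual.
Qed.

Lemma Q_dual F (x y z s : pt) : valid F -> Q F x y z s -> Q (dual F) s z y x.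
Proof.
move=> vF; have uI := can_inj (uK vF).
have shI p q : injective (shift F p q) by rewrite /shift; case: (p && q).
case: x y z s => [[t1 x]|e1] [[t2 y]|e2] [[t3 z]|e3] [[t4 s]|e4] //=.
- case=> et link; rewrite (addbC t4 t3) (addbC t2 t1) -et; split=> //.
  rewrite (addbC t4) /linked; move: link; rewrite /linked !lab_dual /=.
  by case: ifP => _ [e1 e2]; split; rewrite ?e1 // => /omap_None; rewrite -e1 => /e2.
- case=> l [h1 h2 h3]; exists (shift F (t2 (+) t3) (t1 (+) t2) l).
  rewrite lab_dual (addbC t3) (addbC t2 t1) h1 /shift /=.
  by case: (_ && _); rewrite /= ?(uK vF).
- case=> l [h1 h2 h3]; exists (shift F (t1 (+) t4) (t1 (+) t2) l).
  rewrite lab_dual (addbC t4) (addbC t2 t1) h1 /shift /=.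
  by case: (_ && _); rewrite /= ?(uK vF).
- by case=> -> [l [? ? ? ?]]; split=> //; exists l.
- case=> l [h1 h2 h3]; exists (shift F (t1 (+) t4) (t3 (+) t4) l).
  by rewrite lab_dual (addbC t4 t1) (addbC t4 t3) h1.
- case=> -> [l [? ? ? ?]]; split=> //; exists (fu F l).
  by rewrite /= (uK vF).
- by rewrite spare_dual.
- case=> l [h1 h2 h3]; exists (shift F (t2 (+) t3) (t3 (+) t4) l).
  by rewrite lab_dual (addbC t3 t2) (addbC t4 t3) h1.
- by rewrite spare_dual.
- case=> -> [l [? ? ? ?]]; split=> //; exists (fu F l).
  by rewrite /= (uK vF).
- by case=> -> [l [? ? ? ?]]; split=> //; exists l.
Qed.

(** * Unique solvability of [Q] *)

Section Solve.
Variables (F : frame I b) (vF : valid F).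

Lemma rows_lab q x l : rows F x l <-> exists s, lab F true q x s = Some l.
Proof.
rewrite /lab; case: q => /=; first exact: U_rows vF x l.
split=> [/existsP[s /andP[Kxs /eqP <-]]|[s]]; first by exists s; rewrite Kxs.
by case: ifP => // Kxs [<-]; apply/existsP; exists s; rewrite Kxs eqxx.
Qed.

Lemma nrows_lab x l : ~~ rows F x l <-> exists s, lab F false true x s = Some l.
Proof.
rewrite /lab; split=> [nr|[s]].
  have /(@codomP I I (fM F x))[s ls] : l \in codom (fM F x).
    by apply: inj_card_onto => //; apply: M_row vF x.
  exists s; rewrite ls; case: ifP => // Kxs.
  by case/negP: nr; apply/existsP; exists s; rewrite Kxs ls eqxx.
case: ifP => // Kxs [<-]; apply/existsP => -[s' /andP[Kxs' /eqP /(M_row vF) es]].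
by rewrite -es Kxs' in Kxs.
Qed.

Lemma lab_row p q x s s' l :
  lab F p q x s = Some l -> lab F p q x s' = Some l -> s = s'.
Proof.
rewrite /lab; case: p; case: q => //.
- exact: U_row vF x s s' l.
- by case: ifP => // _ [<-]; case: ifP => // _ [/(M_row vF)].
- by case: ifP => // _ [<-]; case: ifP => // _ [/(M_row vF)].
Qed.

Lemma nu_point x l : ~~ rows F x l -> exists e : 'I_b, fnu F x l = e.
Proof.
by have [c1 _ _ _ _] := nu_col vF => /c1 ltb; exists (Ordinal ltb).
Qed.

Lemma row_or_point p q x y z :
  (exists s, [/\ linked F p q x s y z,
      forall s', linked F p q x s' y z -> s = s' &
      forall l, lab F p q y z = Some l -> rows F x l]) \/
  (exists l, [/\ lab F p q y z = Some l, ~~ rows F x l &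
      forall s, ~ linked F p q x s y z]).
Proof.
case: p => /=; last first.
  have /(@codomP I I (fM F x))[s ls] : fM F y z \in codom (fM F x).
    by apply: inj_card_onto => //; apply: M_row vF x.
  have us s' : fM F x s' = fM F y z -> s = s' by rewrite ls => /(M_row vF).
  case: q => /=; last by left; exists s; split=> // s' [/us].
  case Kyz: (fK F y z) => /=.
    by left; exists s; split=> [|s' [/us]|l] //; rewrite ?ls ?orbT // /lab Kyz.
  case r: (rows F x (fM F y z)); last first.
    right; exists (fM F y z); rewrite /lab Kyz r; split=> // s' [e /(_ isT)].
    by rewrite orbF => Kxs'; move/existsP: r => []; exists s'; rewrite Kxs' e eqxx.
  left; exists s; rewrite /lab Kyz; split=> [|s' [/us]|l [<-]] //; split=> // _.
  by case/existsP: r => s' /andP[Kxs' /eqP/us ->]; rewrite Kxs'.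
case e: (lab F true q y z) => [l|].
  case r: (rows F x l); [left|right; exists l; rewrite r; split=> // s].
    have [s xs] := (rows_lab q x l).1 r; exists s; rewrite xs; split=> [//||l' [<-]//].
    by move=> s' [/(lab_row xs)].
  by case=> xs _; have := (rows_lab q x l).2 (ex_intro _ s xs); rewrite r.
(* An unlabelled pair is continued by the unlabelled cell of row [x] with the same colour of
   [fc]. *)
left; have [c1 c2 _ c4 _] := c_col vF q.
have /(c2 x)[s /eqP xs cs] : fc F q y z < b by apply: c1; rewrite e.
exists s; rewrite xs cs; split=> // s' [/eqP xs' /(_ (eqP xs')) cs'].
by apply: (c4 x) => //; rewrite ?xs // cs cs'.
Qed.

Lemma nu_row x (e : 'I_b) : exists l, [/\ ~~ rows F x l, fnu F x l = e &
  forall l', ~~ rows F x l' -> fnu F x l' = e -> l' = l].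
Proof.
have [_ c2 _ c4 _] := nu_col vF; have [l r el] := c2 x e (ltn_ord e).
by exists l; split=> // l' r' el'; apply: (c4 x); rewrite ?el.
Qed.

Lemma nu'_row x (e : 'I_b) : exists l, [/\ ~~ cols F x l, fnu' F x l = e &
  forall l', ~~ cols F x l' -> fnu' F x l' = e -> l' = l].
Proof.
have [_ c2 _ c4 _] := nu'_col vF; have [l r el] := c2 x e (ltn_ord e).
by exists l; split=> // l' r' el'; apply: (c4 x); rewrite ?el.
Qed.

Lemma nu'_col_ex l (e : 'I_b) : exists s, [/\ ~~ cols F s l, fnu' F s l = e &
  forall s', ~~ cols F s' l -> fnu' F s' l = e -> s = s'].
Proof.
have [_ _ c3 _ c5] := nu'_col vF; have [s r el] := c3 l e (ltn_ord e).
by exists s; split=> // s' r' el'; apply: (c5 _ _ l); rewrite ?el.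
Qed.

Lemma lab_rows p q x s l :
  lab F p q x s = Some l -> (p || q) /\ rows F x l = p.
Proof.
case: p => xs.
  by split=> //; apply: (rows_lab q x l).2; exists s.
case: q xs => xs; last by [].
by split=> //; apply/negbTE/(nrows_lab x l).2; exists s.
Qed.

Lemma lab_ex p q x l : p || q -> rows F x l = p -> exists s, lab F p q x s = Some l.
Proof.
case: p => /=; first by move=> _ r; apply: (rows_lab q x l).1.
by move=> -> r; apply: (nrows_lab x l).1; rewrite r.
Qed.

(** Decides, for a first argument in the third block, whether the entry is determined by a label or
    by [fW]. *)
Lemma lab_or_spare t2 t3 y z :
  (exists q l, [/\ lab F (t2 (+) t3) q y z = Some l, ~~ spare F (t2, y) (t3, z) &
     forall q' l', lab F (t2 (+) t3) q' y z = Some l' -> q' = q /\ l' = l]) \/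
  (spare F (t2, y) (t3, z) /\ forall q l, lab F (t2 (+) t3) q y z <> Some l).
Proof.
rewrite /spare /=; have [<-|nt] := eqVneq t2 t3.
  rewrite addbb /lab; case Kyz: (fK F y z); first by right; split=> // -[].
  by left; exists true, (fM F y z); split=> // -[] l' // [->].
have -> : t2 (+) t3 by case: t2 t3 nt => [] [].
rewrite /lab; case Kyz: (fK F y z).
  left; exists false, (fM F y z); split=> // -[] l' => [/(U_K vF)|[->] //].
  by rewrite Kyz.
case Uyz: (fU F y z) => [l|]; last by right; split=> // -[].
by left; exists true, l; split=> // -[] l' // [->].
Qed.

Lemma fL_onto (e : 'I_b) c : c < b -> exists e' : 'I_b, fL F e e' = c :> nat.
Proof.
move=> ltc; have : Ordinal ltc \in codom (fL F e).
  by apply: inj_card_onto => //; apply: L_row vF e.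
by case/codomP=> e' ec; exists e'; rewrite -ec.
Qed.

(** One case for each choice of the arguments lying in the third block. *)
Lemma Q_unique_ex (g1 g2 g3 : pt) : exists! g4, Q F g1 g2 g3 g4.
Proof.
have uI := can_inj (uK vF).
case: g1 g2 g3 => [[t1 x]|e1] [[t2 y]|e2] [[t3 z]|e3] /=.
- have tE t4 : t1 (+) t2 = t3 (+) t4 -> t4 = t1 (+) (t2 (+) t3).
    by case: t1 t2 t3 t4 => [] [] [] [].
  have [[s [link us nl]]|[l [yzl nr nlink]]] := row_or_point (t2 (+) t3) (t1 (+) t2) x y z.
    exists (inl (t1 (+) (t2 (+) t3), s)); split.
      by rewrite addKb; split=> //; case: t1 t2 t3 {link us nl tE} => [] [] [].
    case=> [[t4 s']|e4] []; last by move=> l [/nl ->].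
    by move=> /tE->; rewrite addKb => /us->.
  have [e el] := nu_point nr; exists (inr e); split; first by exists l.
  case=> [[t4 s']|e4] []; first by move=> /tE->; rewrite addKb => /nlink.
  by rewrite yzl => l' [[<-] _ el4]; congr inr; apply: val_inj; rewrite /= -el.
- have [l [ny el ul]] := nu_row y e3.
  case h: (rows F x l || (t1 (+) t2)).
    have [s xs] := lab_ex h erefl; exists (inl (t1 (+) rows F x l, s)); split.
      by exists l; rewrite addKb.
    case=> [[t4 s']|e4].
      case=> l' [xs' ny' el']; have el2 := ul _ ny' el'; rewrite {}el2 in xs'.
      have [_ r] := lab_rows xs'; rewrite r addKb; congr inl; congr pair.
      by rewrite r in xs; apply: lab_row xs xs'.
    case=> et [l' [nx' ny' _ el']]; move: h nx'.
    by rewrite (ul _ ny' el') et addbb orbF => ->.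
  have [nx /negbTE nt] := norP (negbT h).
  have [e ex] := nu_point nx; exists (inr e); split.
    by split; [case: t1 t2 nt {h} => [] [] | exists l].
  case=> [[t4 s']|e4].
    case=> l' [xs' ny' el']; have el2 := ul _ ny' el'; rewrite {}el2 in xs'.
    have [] := lab_rows xs'; rewrite (negbTE nx) nt orbF => h1 h2.
    by rewrite -h2 in h1.
  case=> et [l' [nx' ny' ex' el']]; congr inr; apply: val_inj.
  by rewrite /= -ex -ex' (ul _ ny' el').
- have [n [nz en un]] := nu'_row z e2.
  (* Here [p (+) q] equals [t1 (+) t3]. In different copies exactly one of [p], [q] holds, so
     [shift] is the identity, and [rows F x n] decides which one it is. *)
  case w: (t1 (+) t3).
    have [|s xs] := @lab_ex (rows F x n) (~~ rows F x n) x n _ erefl; first exact: orbN.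
    exists (inl (t1 (+) rows F x n, s)); split.
      exists n; rewrite addKb.
      have -> : t3 (+) (t1 (+) rows F x n) = ~~ rows F x n.
        by case: t1 t3 w => [] [] // _; case: (rows F x n).
      by rewrite /shift andbN.
    case=> [[t4 s']|e4].
      case=> l' []; have -> : t3 (+) t4 = ~~ (t1 (+) t4) by case: t1 t3 t4 w {xs} => [] [] [].
      rewrite /shift andbN => xs' /un nz' {}/nz' el; rewrite {}el in xs'.
      have [_ r] := lab_rows xs'; rewrite r addKb; congr inl; congr pair.
      by rewrite r in xs; apply: lab_row xs xs'.
    by case=> et; rewrite et addbb in w.
  (* In equal copies a label requires both [p] and [q], so [shift] is [fu] and the label is
     [fu' F n]. *)
  have et : t1 = t3 by case: t1 t3 w => [] [].
  have nE : fu F (fu' F n) = n by apply: uK' vF n.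
  case h: (rows F x (fu' F n)).
    have [s xs] := @lab_ex true true x _ isT h; exists (inl (~~ t1, s)); split.
      exists (fu' F n); rewrite -et.
      have -> : t1 (+) ~~ t1 = true by case: t1 {et w}.
      by rewrite /shift /= nE.
    case=> [[t4 s']|e4].
      case=> l' []; rewrite -et; case t14: (t1 (+) t4) => //.
      rewrite /shift /= => xs' /un nz' {}/nz' el.
      have {}el : l' = fu' F n by rewrite -el (uK vF).
      rewrite {}el in xs'; congr inl; congr pair; last exact: lab_row xs xs'.
      by case: t1 t4 t14 {et w} => [] [].
    case=> _ [l' [nx' nz' _ ez']]; have el := un _ nz' ez'.
    by move: nx'; rewrite -(uK vF l') el h.
  have [|e ex] := @nu_point x (fu' F n); first by rewrite h.
  exists (inr e); split; first by split=> //; exists (fu' F n); rewrite h nE.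
  case=> [[t4 s']|e4].
    case=> l' []; rewrite -et; case t14: (t1 (+) t4) => //.
    rewrite /shift /= => xs' /un nz' {}/nz' el.
    have {}el : l' = fu' F n by rewrite -el (uK vF).
    by rewrite {}el in xs'; have [_] := lab_rows xs'; rewrite h.
  case=> _ [l' [nx' nz' ex' ez']]; have el := un _ nz' ez'.
  by congr inr; apply: val_inj; rewrite /= -ex -el (uK vF).
- have [_ c2 _ c4 _] := W_col vF.
  have [h gh wh] := c2 (t1, x) _ (ltn_ord (fL F e2 e3)).
  exists (inl h); split; first by case: h gh wh.
  case=> [[t4 s']|e4]; last by [].
  by case=> gh' wh'; congr inl; apply: (c4 (t1, x)); rewrite // wh.
- have [[q [l [yz nf ul]]]|[f nl]] := lab_or_spare t2 t3 y z.
    have [s [ns es us]] := nu'_col_ex (shift F (t2 (+) t3) q l) e1.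
    exists (inl (t3 (+) q, s)); split; first by exists l; rewrite addKb.
    case=> [[t4 s']|e4]; last by case=> f; rewrite f in nf.
    case=> l' [yz' ns' es']; have [eq el] := ul _ _ yz'; rewrite {}el eq in ns' es'.
    by rewrite -(us _ ns' es') -eq addKb.
  have [c1 _ _ _ _] := W_col vF.
  have [e4 ee4] := fL_onto e1 (c1 _ _ f); exists (inr e4); split; first by [].
  case=> [[t4 s']|e4']; first by case=> l [/nl].
  case=> _ we; congr inr; apply: (L_row vF (t := e1)).
  by apply: val_inj; rewrite /= ee4.
- have [l [ny el ul]] := nu_row y e3; have [s [ns es us]] := nu'_col_ex (fu F l) e1.
  exists (inl (t2, s)); split; first by split=> //; exists l.
  case=> [[t4 s']|e4]; last by [].
  case=> <- [l' [ny' ns' el' es']]; have e := ul _ ny' el'.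
  by rewrite {}e in ns' es'; rewrite (us _ ns' es').
- have [l [ny el ul]] := nu'_row z e2; have [s [ns es us]] := nu'_col_ex l e1.
  exists (inl (t3, s)); split; first by split=> //; exists l.
  case=> [[t4 s']|e4]; last by [].
  case=> <- [l' [ny' ns' el' es']]; have e := ul _ ny' el'.
  by rewrite {}e in ns' es'; rewrite (us _ ns' es').
- have [e4 ee4] := fL_onto e1 (ltn_ord (fL F e2 e3)).
  exists (inr e4); split; first exact: val_inj.
  case=> [[t4 s']|e4']; first by [].
  by move=> e; congr inr; apply: (L_row vF (t := e1)); rewrite e; apply: val_inj.
Qed.

End Solve.

Definition side (g : pt) : option bool := if g is inl (t, _) then Some t else None.

(** Inside one copy of [I] the parity condition keeps the entry in that copy, and the third block is
    excluded because [lab F false false] is empty. *)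
Lemma frame_cube F : valid F ->
  exists f : pt -> pt -> pt -> pt, latin3 f /\ preserves side f.
Proof.
move=> vF; have vD := valid_dual vF.
have Qu G (vG : valid G) g1 g2 g3 g4 g4' : Q G g1 g2 g3 g4 -> Q G g1 g2 g3 g4' -> g4 = g4'.
  by have [s [_ us]] := Q_unique_ex vG g1 g2 g3; move=> /us<- /us.
have Q1 g1 g1' g2 g3 g4 : Q F g1 g2 g3 g4 -> Q F g1' g2 g3 g4 -> g1 = g1'.
  by move=> /(Q_dual vF) q /(Q_dual vF); apply: Qu vD _ _ _ _ _ q.
have [||||f [latf fQ]] := @latin3_of_rel pt (Q F).
- by move=> g1 g2 g3; have [g4 [? _]] := Q_unique_ex vF g1 g2 g3; exists g4.
- exact: Q1.
- by move=> g1 g2 g2' g3 g4 /Q_swap q /Q_swap; apply: Q1 q.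
- by move=> g1 g2 g3 g3' g4 /Q_swap q /Q_swap; apply: Qu q.
exists f; split=> // g1 g2 g3; move: (f g1 g2 g3) (fQ g1 g2 g3) => g4.
case: g4 g1 g2 g3 => [[t4 s]|e4] [[t1 x]|e1] [[t2 y]|e2] [[t3 z]|e3] //=.
  by case=> et _ [e12] [e23]; move: et; rewrite e12 e23 addbb => /esym/eqP;
    case: t3 t4 {e12 e23} => [] [].
by case=> l [h _ _] [e12] [e23]; move: h; rewrite e12 e23 addbb.
Qed.

End Frame.

(** * The data of a cube from a plex *)

Lemma regular_compl (T : finType) (E : rel T) d b :
  #|T| = d + b -> regular E d -> regular (fun x y => ~~ E x y) b.
Proof.
move=> cT [rowE colE]; split=> x.
  have := cardsC [set y | E x y]; rewrite rowE cT => /addnI <-.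
  by congr #|pred_of_set _|; apply/setP=> y; rewrite !inE.
have := cardsC [set y | E y x]; rewrite colE cT => /addnI <-.
by congr #|pred_of_set _|; apply/setP=> y; rewrite !inE.
Qed.

(* [K] is a d-plex of the latin square [M], and [t] permutes the columns so
   that the translated plex is disjoint from [K] while the family of the column
   sets of the symbols of [K] is only permuted, by [u]. *)
Record plex (I : finType) (d : nat) (M : I -> I -> I) (K : rel I)
    (t u : I -> I) : Prop := Plex {
  plex_row : forall x, injective (M x);
  plex_col : forall s, injective (M ^~ s);
  plex_K : regular K d;
  plex_lab : forall j, #|[set x | lrow M K x j]| = d;
  plex_t : injective t;
  plex_u : injective u;
  plex_dis : forall x s, K x s -> ~~ K x (t s);
  plex_tu : forall s j, lrow (fun s x => M x s) (fun s x => K x s) (t s) (u j) =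
                        lrow (fun s x => M x s) (fun s x => K x s) s j
}.

Lemma coloring_ext (T : finType) (E E' : rel T) r c :
  E' =2 E -> coloring E r c -> coloring E' r c.
Proof.
move=> eE cE; have cE' := @coloring_flip T E (fun x y => E y x) r c (fun _ _ => erefl) cE.
by apply: coloring_flip cE' => x y; rewrite eE.
Qed.

Section PlexFrame.
Variables (I : finType) (d b : nat) (M : I -> I -> I) (K : rel I) (t u : I -> I).
Hypothesis P : plex d M K t u.
Hypothesis cI : #|I| = d + b.
Hypothesis ledb : d <= b.

Let Mt s x := M x s.
Let Kt s x := K x s.
Let Mr x : injective (M x). Proof. exact: (@plex_row _ _ _ _ _ _ P). Qed.
Let Mc s : injective (M ^~ s). Proof. exact: (@plex_col _ _ _ _ _ _ P). Qed.
Let t' := invF (plex_t P).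
(** The translate of the plex by [t], carrying its symbols: rows keep their symbol sets, and by
    [plex_tu] columns keep theirs up to [u]. *)
Let U x s := if K x (t' s) then Some (M x (t' s)) else None.

Let lrow_card x : #|[set j | lrow M K x j]| = d.
Proof.
rewrite -((plex_K P).1 x) -[RHS](card_imset _ (@Mr x)).
congr #|pred_of_set _|; apply/setP=> j; rewrite inE.
apply/existsP/imsetP => -[s].
  by case/andP=> Kxs /eqP <-; exists s; rewrite ?inE.
by rewrite inE => Kxs ->; exists s; rewrite Kxs eqxx.
Qed.

Let lcol_card s : #|[set j | lrow Mt Kt s j]| = d.
Proof.
rewrite -((plex_K P).2 s) -[RHS](card_imset _ (@Mc s)).
congr #|pred_of_set _|; apply/setP=> j; rewrite inE.
apply/existsP/imsetP => -[x].
  by case/andP=> Kxs /eqP <-; exists x; rewrite ?inE.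
by rewrite inE => Kxs ->; exists x; rewrite /Kt Kxs /= /Mt.
Qed.

(** The cells with symbol [j] lie in distinct rows and distinct columns, so [plex_lab] counts
    columns as well. *)
Let lcol_lab j : #|[set s | lrow Mt Kt s j]| = d.
Proof.
have Mj x : exists s, M x s = j.
  have /(@codomP I I (M x))[s ->] : j \in codom (M x).
    by apply: inj_card_onto => //; apply: Mr.
  by exists s.
have [g gj] := fin_all_exists Mj.
have gI : injective g.
  by move=> x x' e; apply: (@Mc (g x)); rewrite gj e gj.
rewrite -(plex_lab P j) -[RHS](card_imset _ gI).
congr #|pred_of_set _|; apply/setP=> s; rewrite inE.
apply/existsP/imsetP => -[x].
  case/andP=> Kxs /eqP e; have es : s = g x by apply: (@Mr x); rewrite gj.
  by exists x; rewrite // inE; apply/existsP; exists s; apply/andP; split=> //; apply/eqP.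
rewrite inE => /existsP[s' /andP[Kxs' /eqP e]] es.
have es' : s' = g x by apply: (@Mr x); rewrite gj.
by exists x; rewrite // es; apply/andP; rewrite /Kt /Mt -es' e.
Qed.

Let lrow_regular : regular (lrow M K) d.
Proof. by split=> x; [apply: lrow_card | apply: plex_lab P x]. Qed.

Let lcol_regular : regular (lrow Mt Kt) d.
Proof. by split=> x; [apply: lcol_card | apply: lcol_lab]. Qed.

Let t'K s : t (t' s) = s.
Proof. exact: f_invF. Qed.

Let tK s : t' (t s) = s.
Proof. exact: invF_f. Qed.

Let U_none x s : (U x s == None) = ~~ K x (t' s).
Proof. by rewrite /U; case: ifP. Qed.

Let Kt'_regular : regular (fun x s => K x (t' s)) d.
Proof.
split=> x; last exact: (plex_K P).2.
rewrite -((plex_K P).1 x) -[RHS](card_imset _ (plex_t P)).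
congr #|pred_of_set _|; apply/setP=> s; rewrite inE.
apply/idP/imsetP => [Ks|[s']]; first by exists (t' s); rewrite ?inE ?t'K.
by rewrite inE => Ks' ->; rewrite tK.
Qed.

Let K_dis x s : K x (t' s) -> ~~ K x s.
Proof. by move=> Ks; rewrite -[s]t'K; apply: plex_dis P _ _ Ks. Qed.

Let spare0 (g h : bool * I) :=
  if g.1 == h.1 then K g.2 h.2 else ~~ K g.2 h.2 && ~~ K g.2 (t' h.2).

(** A point has [d] spare partners in its own copy and [#|I| - 2 * d = b - d] in the other. *)
Let spare_regular : regular spare0 b.
Proof.
have count (D D' : {set I}) c : #|D| = d -> #|D'| = d -> [disjoint D & D'] ->
    #|[set h : bool * I | if c == h.1 then h.2 \in D
                 else (h.2 \notin D) && (h.2 \notin D')]| = b.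
  move=> cD cD' dDD'; pose E := ~: (D :|: D').
  have cE : #|E| = b - d.
    have := cardsC (D :|: D'); rewrite cardsU cD cD' cI.
    move: dDD'; rewrite -setI_eq0 => /eqP ->; rewrite cards0 subn0.
    by rewrite -addnA => /addnI <-; rewrite addKn.
  rewrite -(subnKC ledb) -cE -cD.
  rewrite (_ : [set h | _] = [set (c, x) | x in D] :|: [set (~~ c, x) | x in E]).
    rewrite cardsU !card_imset; try by move=> x y [].
    rewrite (_ : _ :&: _ = set0) ?cards0 ?subn0 //; apply/setP=> h; rewrite !inE.
    apply/negbTE/andP=> -[/imsetP[x _ ->] /imsetP[y _ []]].
    by case: (c).
  apply/setP=> -[c' x]; rewrite !inE /=.
  have eC (e : bool) (S : {set I}) :
      ((c', x) \in [set (e, y) | y in S]) = (c' == e) && (x \in S).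
    apply/imsetP/andP => [[y yS [-> ->]]|[/eqP-> xS]]; first by rewrite eqxx.
    by exists x.
  rewrite !eC !inE negb_or.
  by case: (c); case: (c') => //=; rewrite orbF.
split=> -[c x].
  have := @count [set s | K x s] [set s | K x (t' s)] c ((plex_K P).1 x) (Kt'_regular.1 x).
  rewrite -setI_eq0 (_ : _ :&: _ = set0) => [<- //|].
    by congr #|pred_of_set _|; apply/setP=> h; rewrite !inE.
  by apply/setP=> s; rewrite !inE; case h: (K x (t' s)); rewrite ?andbF ?(negbTE (K_dis h)).
have := @count [set s | K s x] [set s | K s (t' x)] c ((plex_K P).2 x) (Kt'_regular.2 x).
rewrite -setI_eq0 (_ : _ :&: _ = set0) => [<- //|].
  by congr #|pred_of_set _|; apply/setP=> h; rewrite !inE /spare0 eq_sym.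
by apply/setP=> s; rewrite !inE; case h: (K s (t' x)); rewrite ?andbF ?(negbTE (K_dis h)).
Qed.

(** All relations to be coloured are regular of degree [b], so [konig] applies to each. *)
Lemma plex_frame : exists F : frame I b, valid F.
Proof.
have [nu nuP] := konig (regular_compl cI lrow_regular).
have [nu' nu'P] := konig (regular_compl cI lcol_regular).
have [c0 c0P] := konig (regular_compl cI (plex_K P)).
have [c1 c1P] := konig (regular_compl cI Kt'_regular).
have [W WP] := konig spare_regular.
(* A cyclic group table; the group structure on ['I_b] requires positive [b]. *)
have [L [L_row L_col]] : exists L : 'I_b -> 'I_b -> 'I_b,
    (forall e, injective (L e)) /\ (forall e, injective (L ^~ e)).
  case: (b) => [|n]; first by exists (fun e _ => e); split=> -[].
  exists (fun e e' => e + e')%R; split=> e; [exact: GRing.addrI|exact: GRing.addIr].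
pose F := Frame M K U u (invF (plex_u P)) nu nu' (fun q => if q then c1 else c0) W L.
exists F; split=> //=.
- move=> x s s' j; rewrite /U; case: ifP => // _ [<-]; case: ifP => // _ [e].
  by rewrite -[s]t'K -[s']t'K (Mr e).
- move=> x x' s j; rewrite /U; case: ifP => // _ [<-]; case: ifP => // _ [e].
  by apply/esym: (Mc e).
- move=> x j; split=> [/existsP[s /andP[Kxs /eqP <-]]|[s]].
    by exists (t s); rewrite /U tK [K x s]Kxs.
  rewrite /U; case: ifP => // Ks [<-]; apply/existsP; exists (t' s).
  by apply/andP; rewrite /= Ks.
- move=> s j; rewrite -[s]t'K [cols _ _ _](plex_tu P) t'K.
  split=> [/existsP[x /andP[Kxs /eqP <-]]|[x]].
    by exists x; rewrite /U [K x _]Kxs.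
  rewrite /U; case: ifP => // Ks [<-]; apply/existsP; exists x.
  by apply/andP; rewrite /= Ks.
- by move=> x s j; rewrite /U; case: ifP => // /K_dis/negbTE.
- exact: invF_f.
- exact: f_invF.
- by case; [apply: coloring_ext c1P => x s; apply: U_none
            | apply: coloring_ext c0P => x s; rewrite /lab /=; case: (K x s)].
- apply: coloring_ext WP => g h; rewrite /spare /spare0 /=.
  by case: (g.1 == h.1) => //; congr (_ && _); apply: U_none.
Qed.

End PlexFrame.

Lemma plex_cube (I : finType) (a d : nat) M (K : rel I) t u :
  plex d M K t u -> #|I| = a -> d.*2 <= a ->
  exists (T : finType) (f : T -> T -> T -> T) (cls : T -> option bool),
    [/\ latin3 f, preserves cls f, forall c, #|[set x | cls x == Some c]| = a &
        #|[set x | cls x == None]| = a - d].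
Proof.
move=> P cI led; have leda : d <= a by apply: leq_trans led; rewrite -addnn leq_addr.
have ledb : d <= a - d by rewrite leq_subRL // addnn.
have [|F vF] := plex_frame P _ ledb; first by rewrite subnKC.
have [f [latf clsf]] := frame_cube vF.
exists (pt I (a - d)), f, (@side I (a - d)); split=> // [c|].
  transitivity #|[set (inl (c, x) : pt I (a - d)) | x : I]|.
    congr #|pred_of_set _|; apply/setP=> -[[c' x]|e]; rewrite !inE /=.
      by apply/eqP/imsetP => [[->]|[y _ [-> _]]] //; exists x.
    by apply/esym/imsetP => -[].
  by rewrite card_imset ?cardsT // => x y [].
transitivity #|[set (inr e : pt I (a - d)) | e : 'I_(a - d)]|.
  congr #|pred_of_set _|; apply/setP=> -[[c' x]|e]; rewrite !inE /=.
    by apply/esym/imsetP => -[].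
  by apply/esym/imsetP; exists e.
by rewrite card_imset ?cardsT ?card_ord // => x y [].
Qed.

(** * Plexes from abelian groups *)

HB.saturate prod.

(* In such a group, with [hi e = lo e + e], the square [(x, s) |-> x - lo (s - x)]
   is latin and each of its difference classes is a transversal. *)
Record good_group (G : finZmodType) (lo : G -> G) : Prop := GoodGroup {
  loD : forall x y, lo (x + y)%R = (lo x + lo y)%R;
  lo_inj : injective lo;
  hi_inj : injective (fun x => (lo x + x)%R);
  shiftable : forall e, e.*2 <= #|G| -> exists (h : G) (A : {set G}),
    #|A| = e /\ forall x, x \in A -> (x + h)%R \notin A
}.

(** With [lo] the identity, [hi] is doubling, which is injective in odd order. *)
Lemma good_group_odd n : odd n ->
  exists (G : finZmodType) (lo : G -> G), #|G| = n /\ good_group lo.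
Proof.
case: n => // n on; exists 'I_n.+1, id; split; first by rewrite card_ord.
split=> // [x y /= exy|e].
  have h (i j : 'I_n.+1) : i <= j -> (i + i)%R = (j + j)%R -> i = j.
    move=> leij /(congr1 val) /= /eqP; rewrite eq_sym eqn_mod_dvd ?leq_add //.
    rewrite !addnn -doubleB -mul2n Gauss_dvdr ?coprimen2 // => dvd.
    apply/val_inj/anti_leq; rewrite leij -subn_eq0 /=.
    case: posnP => // pos; move: dvd; rewrite gtnNdvd //.
    by rewrite (leq_ltn_trans (leq_subr _ _)).
  case: (leqP x y) => [lexy|/ltnW leyx]; first exact: h.
  by apply/esym/h.
(* An initial interval of length [e], shifted by its own length, does not wrap around. *)
rewrite card_ord => le; exists (inord e), [set x : 'I_n.+1 | x < e]; split=> [|x].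
  have len : e <= n.+1 by apply: leq_trans le; rewrite -addnn leq_addr.
  have wI : injective (widen_ord len) by move=> i j /(congr1 val) e_ij; apply: val_inj.
  rewrite -[RHS]card_ord -(card_imset _ wI).
  congr #|pred_of_set _|; apply/setP=> x; rewrite inE.
  apply/idP/imsetP => [ltx|[y _ ->]]; last exact: (valP y).
  by exists (Ordinal ltx) => //; apply: val_inj.
rewrite !inE -leqNgt /= => ltx.
have lt_e : x + e < n.+1 by apply: leq_trans le; rewrite -addnn ltn_add2r.
by rewrite inordK ?modn_small ?leq_addl // (leq_ltn_trans _ lt_e) ?leq_addl.
Qed.

Lemma subset_of_card (T : finType) (S : {set T}) e : e <= #|S| ->
  exists2 A : {set T}, A \subset S & #|A| = e.
Proof.
move=> le; exists [set x in take e (enum S)].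
  by apply/subsetP=> x; rewrite inE => /mem_take; rewrite mem_enum.
rewrite cardsE; have /card_uniqP-> : uniq (take e (enum S)) by rewrite take_uniq ?enum_uniq.
by rewrite size_take -cardE; case: ltngtP le.
Qed.

(** On ['I_2 * 'I_2], [lo'] is multiplication by a generator of the field with four elements, so it
    stays invertible when the identity is added. Translation by [((1, 0), 0)] leaves the half [S],
    from which [A] is taken. *)
Lemma good_group4 (G : finZmodType) (lo : G -> G) : good_group lo ->
  exists (G' : finZmodType) (lo' : G' -> G'), #|G'| = 4 * #|G| /\ good_group lo'.
Proof.
case=> loD lo_inj hi_inj _.
pose G' : finZmodType := ('I_2 * 'I_2 * G)%type.
pose lo' (g : G') : G' := (g.1.2, g.1.1 + g.1.2, lo g.2)%R.
exists G', lo'; split; first by rewrite /G' !card_prod !card_ord.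
have e2 (x : 'I_2) : (x + x = 0)%R by case: x => -[|[|]] // ?; apply: val_inj.
split=> [[[x1 x2] x] [[y1 y2] y]|[[x1 x2] x] [[y1 y2] y] eg|
         [[x1 x2] x] [[y1 y2] y] eg|e le].
- by rewrite /lo' /= loD GRing.addrACA.
- have e1 : x2 = y2 := congr1 (fun g : G' => g.1.1) eg.
  have e3 : (x1 + x2 = y1 + y2)%R := congr1 (fun g : G' => g.1.2) eg.
  have e4 : lo x = lo y := congr1 (fun g : G' => g.2) eg.
  by move: e3; rewrite (lo_inj _ _ e4) e1 => /GRing.addIr ->.
- have e1 : (x2 + x1 = y2 + y1)%R := congr1 (fun g : G' => g.1.1) eg.
  have e3 : (x1 + x2 + x2 = y1 + y2 + y2)%R := congr1 (fun g : G' => g.1.2) eg.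
  have e4 : (lo x + x = lo y + y)%R := congr1 (fun g : G' => g.2) eg.
  move: e3; rewrite -!GRing.addrA !e2 !GRing.addr0 => e3.
  by move: e1; rewrite (hi_inj _ _ e4) e3 => /GRing.addIr ->.
- pose S := [set g : G' | g.1.1 == 0%R].
  have [|A /subsetP sA cA] := @subset_of_card _ S e.
    pose f (p : 'I_2 * G) : G' := ((0%R, p.1), p.2).
    have fI : injective f by move=> [p x] [q y] [-> ->].
    rewrite (_ : S = f @: setT).
      rewrite card_imset // cardsT card_prod card_ord -leq_double.
      by apply: leq_trans le _; rewrite !card_prod !card_ord -mul2n mulnA.
    apply/setP=> -[[x1 x2] x]; rewrite inE /=; apply/eqP/imsetP => [->|[p _ [-> _ _]]] //.
    by exists (x2, x).
  exists ((1, 0), 0)%R, A; split=> // g gA; apply/negP=> /sA.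
  by have := sA _ gA; rewrite !inE /= => /eqP ->.
Qed.

Section GroupPlex.
Variables (G : finZmodType) (lo : G -> G).
Hypothesis gG : good_group lo.
Local Open Scope ring_scope.
Import GRing.Theory.

Let hi e := lo e + e.

Let hiD x y : hi (x + y) = hi x + hi y.
Proof. by rewrite /hi (loD gG) addrACA. Qed.

(** The symbol of a cell seen from its row and from its column: [lo] governs rows, [hi] columns. *)
Let lo_hi (x s : G) : x - lo (s - x) = s - hi (s - x).
Proof. by rewrite /hi [lo _ + _]addrC opprD addrA subKr. Qed.

Definition group_square (x s : G) := x - lo (s - x).

Lemma group_square_row x : injective (group_square x).
Proof. by move=> s s' /addrI/oppr_inj/(lo_inj gG)/addIr. Qed.

Lemma group_square_col s : injective (group_square ^~ s).
Proof.
by move=> x x'; rewrite /group_square !lo_hi => /addrI/oppr_inj/(hi_inj gG)/addrI/oppr_inj.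
Qed.

Lemma card_diff_row (A : {set G}) x : #|[set s | s - x \in A]| = #|A|.
Proof.
rewrite -(@card_preimset _ (fun s => s - x) A) => [|s s' /addIr //].
by congr #|pred_of_set _|; apply/setP=> s; rewrite !inE.
Qed.

Lemma card_diff_col (A : {set G}) s : #|[set x | s - x \in A]| = #|A|.
Proof.
rewrite -(@card_preimset _ (fun x => s - x) A) => [|x x' /addrI/oppr_inj //].
by congr #|pred_of_set _|; apply/setP=> x; rewrite !inE.
Qed.

(** On the difference [e], symbol [j] occurs in row [j + lo e] and column [j + hi e]. Translating
    columns by [h] moves the differences from [A] to [A + h], and translating the symbols along
    restores the column sets. *)
Lemma group_plex (A : {set G}) (h : G) : (forall x, x \in A -> x + h \notin A) ->
  plex #|A| group_square (fun x s => s - x \in A) (+%R^~ h) (+%R^~ h).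
Proof.
move=> Ah; split.
- exact: group_square_row.
- exact: group_square_col.
- by split=> x; [apply: card_diff_row | apply: card_diff_col].
- move=> j; have jI : injective (fun e => j + lo e) by move=> e e' /addrI/(lo_inj gG).
  rewrite -[RHS](card_imset _ jI); congr #|pred_of_set _|; apply/setP=> x; rewrite inE.
  apply/existsP/imsetP => [[s /andP[sA /eqP <-]]|[e eA ->]].
    by exists (s - x); rewrite // subrK.
  exists (j + lo e + e); rewrite /group_square [_ + e]addrC addrK eA.
  by rewrite addrK eqxx.
- exact: addIr.
- exact: addIr.
- by move=> x s /Ah; rewrite addrAC.
move=> s j; apply/existsP/existsP => -[x /andP[sA /eqP e]].
  have e0 : s - (x - h) = s + h - x by rewrite opprB addrA.
  exists (x - h); rewrite /group_square e0 sA addrAC.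
  by rewrite [x - lo _]e addrK eqxx.
have e0 : s + h - (x + h) = s - x by rewrite opprD addrACA subrr addr0.
exists (x + h); rewrite /group_square e0 sA addrAC.
by rewrite [x - lo _]e eqxx.
Qed.

Variables (A A' : {set G}) (h : G).
Hypothesis Ah : forall x, x \in A -> x + h \notin A.
Hypothesis sA : A' \subset A.

(** On copy [c] the plex has the differences in [B c false], with symbol bit false, and those in the
    translate of [B c true] by [h], with symbol bit true. Each copy and each bit thus uses [A] once
    and [A'] once. *)
Let B (c i : bool) := if c == i then A else A'.
Let hb (i : bool) := if i then h else 0.
Let eta e := e - h \in A.
Let Om c e := (e \in B c false) || (e - h \in B c true).

(* Abelian groups of order 2 modulo 4 are not good, hence the detour by
   G * bool; A and A' are to have sizes ceil(d/2) and floor(d/2). *)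
Definition double_square (x s : G * bool) :=
  (group_square x.1 s.1, x.2 (+) s.2 (+) eta (s.1 - x.1)).

Definition double_plex (x s : G * bool) := (x.2 == s.2) && Om x.2 (s.1 - x.1).

(** Flipping both copy and bit leaves [B c i] unchanged, and [hi h] compensates for [hb i] in the
    columns [m + hi (e + hb i)] of the symbol [(m, i)]. *)
Definition double_shift (j : G * bool) :=
  (if j.2 then j.1 + hi h else j.1 - hi h, ~~ j.2).

Let sB c i : B c i \subset A.
Proof. by rewrite /B; case: ifP. Qed.

Let OmE c i e : Om c e && (eta e == i) = (e - hb i \in B c i).
Proof.
have Ah' x : x - h \in A -> x \notin A by move/Ah; rewrite subrK.
have Bh d x : x - h \in B d true -> x - h \in A by apply: (subsetP (sB d true)).
have B0 d x : x \in B d false -> x \in A by apply: (subsetP (sB d false)).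
rewrite /Om /eta; case: i; rewrite /= ?subr0.
  case eA: (e - h \in A); last first.
    by rewrite andbF; apply/esym/negP=> /Bh; rewrite eA.
  rewrite andbT; case: (boolP (e \in B c false)) => //= /B0.
  by rewrite (negbTE (Ah' _ eA)).
case eA: (e - h \in A).
  rewrite andbF; apply/esym/negP=> /B0; apply/negP/Ah'; exact: eA.
rewrite andbT; case: (boolP (e - h \in B c true)) => [/Bh|]; first by rewrite eA.
by rewrite orbF.
Qed.

(** Plex cells join points of equal copy, so flipping the copy of the column gives a disjoint
    translate at once. *)
Lemma double_group_plex :
  plex (#|A| + #|A'|) double_square double_plex (fun s => (s.1, ~~ s.2)) double_shift.
Proof.
have card_Om c : #|[set e | Om c e]| = (#|A| + #|A'|)%N.
  have hI : injective (+%R^~ h) by apply: addIr.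
  have -> : [set e | Om c e] = B c false :|: [set e + h | e in B c true].
    apply/setP=> e; rewrite !inE; congr (_ || _).
    apply/idP/imsetP => [eB|[x xB ->]]; last by rewrite addrK.
    by exists (e - h); rewrite ?subrK.
  rewrite cardsU card_imset // (_ : _ :&: _ = set0) ?cards0 ?subn0; last first.
    apply/setP=> e; rewrite !inE; apply/negbTE/andP=> -[/(subsetP (sB _ _)) eA].
    by case/imsetP=> x /(subsetP (sB _ _))/Ah/negP xA ex; rewrite -ex in xA.
  by rewrite /B; case: c => //=; rewrite addnC.
have labE x c m i : lrow double_square double_plex (x, c) (m, i) =
    (x \in [set m + lo (e + hb i) | e in B c i]).
  apply/existsP/imsetP => [[[s c'] /andP[/andP[/= /eqP <- oms] /eqP[em ei]]]|[e eB ->]].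
    exists (s - x - hb i); last by rewrite subrK -em subrK.
    by rewrite -OmE oms /= -ei addbb addFb.
  exists (m + lo (e + hb i) + (e + hb i), c); rewrite /double_plex /double_square /=.
  rewrite /group_square [_ + (e + _)]addrC !addrK eqxx addbb addFb xpair_eqE eqxx /=.
  by rewrite OmE addrK.
have colE s c m i : lrow (fun s x => double_square x s) (fun s x => double_plex x s)
    (s, c) (m, i) = (s \in [set m + hi (e + hb i) | e in B c i]).
  apply/existsP/imsetP => [[[x c'] /andP[/andP[/= /eqP -> oms] /eqP[em ei]]]|[e eB ->]].
    exists (s - x - hb i); last by rewrite subrK -em /group_square lo_hi subrK.
    by rewrite -OmE oms /= -ei addbb addFb.
  exists (m + lo (e + hb i), c); rewrite /double_plex /double_square /=.
  have -> : m + hi (e + hb i) - (m + lo (e + hb i)) = e + hb i.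
    by rewrite /hi addrA [_ + (e + _)]addrC addrK.
  have -> : group_square (m + lo (e + hb i)) (m + hi (e + hb i)) = m.
    by rewrite /group_square /hi addrA [_ + (e + _)]addrC !addrK.
  by rewrite eqxx addbb addFb xpair_eqE eqxx /= OmE addrK.
split.
- move=> [x c] [s c1] [s' c2] [/group_square_row -> e]; congr pair.
  by move: e; case: (eta _) c c1 c2 => [] [] [] [].
- move=> [s c] [x c1] [x' c2] [/group_square_col -> e]; congr pair.
  by move: e; case: (eta _) c c1 c2 => [] [] [] [].
- split=> -[x c].
    have xI : injective (fun s : G => (s, c)) by move=> s s' [].
    rewrite -(card_Om c) -(card_diff_row _ x) -(card_imset _ xI).
    congr #|pred_of_set _|; apply/setP=> -[s c']; rewrite !inE /double_plex /=.
    apply/andP/imsetP => [[/eqP <- oms]|[s']]; first by exists s; rewrite ?inE.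
    by rewrite !inE => oms [-> ->].
  have xI : injective (fun s : G => (s, c)) by move=> s s' [].
  rewrite -(card_Om c) -(card_diff_col _ x) -(card_imset _ xI).
  congr #|pred_of_set _|; apply/setP=> -[s c']; rewrite !inE /double_plex /=.
  apply/andP/imsetP => [[/eqP -> oms]|[s']]; first by exists s; rewrite ?inE.
  by rewrite !inE => oms [-> ->].
- case=> m i; pose f c e := (m + lo (e + hb i), c : bool).
  have fI c : injective (f c) by move=> e e' [/addrI/(lo_inj gG)/addIr].
  have -> : [set x | lrow double_square double_plex x (m, i)] =
      f i @: B i i :|: f (~~ i) @: B (~~ i) i.
    apply/setP=> -[x c]; rewrite !inE labE.
    have eC d : ((x, c) \in f d @: B d i) =
        (c == d) && (x \in [set m + lo (e + hb i) | e in B d i]).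
      apply/imsetP/andP => [[e eB [-> ->]]|[/eqP-> /imsetP[e eB ->]]].
        by split=> //; apply/imsetP; exists e.
      by exists e.
    by rewrite !eC; case: (c) (i) => [] [] /=; rewrite ?orbF.
  rewrite cardsU !card_imset // (_ : _ :&: _ = set0) ?cards0 ?subn0; last first.
    apply/setP=> x; rewrite !inE; apply/negbTE/andP=> -[/imsetP[e _ ->] /imsetP[e' _ []]].
    by case: (i).
  by rewrite /B; case: (i).
- by move=> [s c] [s' c'] [-> /negb_inj ->].
- by move=> [m i] [m' i'] [e /negb_inj ei]; move: e; rewrite ei; case: ifP => _ /addIr ->.
- by move=> [x c] [s c'] /andP[/= /eqP -> _]; rewrite /double_plex /=; case: c'.
move=> [s c] [m i]; rewrite /double_shift /= !colE.
have -> : B (~~ c) (~~ i) = B c i by rewrite /B; case: c i => [] [].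
congr (s \in pred_of_set _); apply: eq_imset => e; case: i => /=.
  by rewrite addr0 -addrA [hi h + _]addrC hiD.
by rewrite addr0 hiD addrA addrAC addrNK.
Qed.

End GroupPlex.

(** Factors 4 are split off by [good_group4] until an odd number or twice an odd number remains. *)
Lemma good_group_or_double a : 0 < a ->
  (exists (G : finZmodType) (lo : G -> G), #|G| = a /\ good_group lo) \/
  (exists (G : finZmodType) (lo : G -> G), #|G|.*2 = a /\ good_group lo).
Proof.
have [n] := ubnP a; elim: n a => // n IHn a lean a0.
have [oa|ea] := boolP (odd a); first by left; apply: good_group_odd.
have {ea} ea : a = a./2.*2 by rewrite -[LHS]odd_double_half (negbTE ea).
have [oh|eh] := boolP (odd a./2).
  by right; have [G [lo [cG gG]]] := good_group_odd oh; exists G, lo; rewrite cG.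
have {}eh : a = 4 * (a./2)./2.
  by rewrite {1}ea -{1}[a./2]odd_double_half (negbTE eh) add0n -!mul2n mulnA.
set m := (a./2)./2 in eh; have m0 : 0 < m by move: a0; rewrite eh muln_gt0.
have [|[G [lo [cG gG]]]|[G [lo [cG gG]]]] := IHn m _ m0.
- by apply: leq_trans (ltnSE lean); rewrite [X in _ < X]eh ltn_Pmull.
- by left; have [G' [lo' [cG' gG']]] := good_group4 gG; exists G', lo'; rewrite cG' cG -eh.
right; have [G' [lo' [cG' gG']]] := good_group4 gG; exists G', lo'.
by rewrite cG' -muln2 -mulnA muln2 cG -eh.
Qed.

(** * Blocks of orders 2g, 2g and g *)

Definition pt5 : finType := option (bool * bool).

Definition index5 (x : pt5) : nat :=
  if x is Some (c, i) then c.*2 + i else 4.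

Definition point5 (n : nat) : pt5 := nth None
  [:: Some (false, false); Some (false, true); Some (true, false); Some (true, true)] n.

(* A latin cube of order 5 with disjoint subcubes of orders 2, 2, 1, found by a
   computer search. *)
Definition cube5 (x y z : pt5) : pt5 := point5 (nth 0 (nth [::] (nth [::]
  [:: [:: [:: 0; 1; 2; 3; 4]; [:: 1; 0; 3; 4; 2]; [:: 2; 4; 1; 0; 3];
          [:: 3; 2; 4; 1; 0]; [:: 4; 3; 0; 2; 1]];
      [:: [:: 1; 0; 4; 2; 3]; [:: 0; 1; 2; 3; 4]; [:: 3; 2; 0; 4; 1];
          [:: 4; 3; 1; 0; 2]; [:: 2; 4; 3; 1; 0]];
      [:: [:: 2; 3; 1; 4; 0]; [:: 4; 2; 0; 1; 3]; [:: 1; 0; 2; 3; 4];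
          [:: 0; 4; 3; 2; 1]; [:: 3; 1; 4; 0; 2]];
      [:: [:: 3; 4; 0; 1; 2]; [:: 2; 3; 4; 0; 1]; [:: 4; 1; 3; 2; 0];
          [:: 1; 0; 2; 3; 4]; [:: 0; 2; 1; 4; 3]];
      [:: [:: 4; 2; 3; 0; 1]; [:: 3; 4; 1; 2; 0]; [:: 0; 3; 4; 1; 2];
          [:: 2; 1; 0; 4; 3]; [:: 1; 0; 2; 3; 4]]]
  (index5 x)) (index5 y)) (index5 z)).

Definition side5 (x : pt5) : option bool := omap fst x.

Lemma cube5_latin : latin3 cube5.
Proof.
by split; move=> [[[] []]|] [[[] []]|] [[[] []]|] [[[] []]|].
Qed.

Lemma cube5_side : preserves side5 cube5.
Proof. by move=> [[[] []]|] [[[] []]|] [[[] []]|]. Qed.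

(** The product of [cube5] with the cyclic cube of order [g]. *)
Lemma inflated_cube5 g : 0 < g ->
  exists (T : finType) (f : T -> T -> T -> T) (cls : T -> option bool),
    [/\ latin3 f, preserves cls f, forall c, #|[set x | cls x == Some c]| = g.*2 &
        #|[set x | cls x == None]| = g].
Proof.
case: g => // g _; have [f1 f2 f3] := cube5_latin.
exists (pt5 * 'I_g.+1)%type, (fun x y z => (cube5 x.1 y.1 z.1, (x.2 + y.2 + z.2)%R)).
exists (side5 \o fst); split.
- split=> [[y j] [z k] [x i] [x' i']|[x i] [z k] [y j] [y' j']|[x i] [y j] [z k] [z' k']] e.
  + by have /= /f1 -> := congr1 fst e; have /= /GRing.addIr/GRing.addIr -> := congr1 snd e.
  + by have /= /f2 -> := congr1 fst e; have /= /GRing.addIr/GRing.addrI -> := congr1 snd e.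
  + by have /= /f3 -> := congr1 fst e; have /= /GRing.addrI -> := congr1 snd e.
- by move=> x y z; apply: cube5_side.
- move=> c; transitivity #|[set (Some (c, p.1) : pt5, p.2) | p : bool * 'I_g.+1]|.
    congr #|pred_of_set _|; apply/setP=> -[[[c' i]|] j]; rewrite !inE /=.
      by apply/eqP/imsetP => [[->]|[p _ [-> _ _]]] //; exists (i, j).
    by apply/esym/imsetP => -[].
  rewrite card_imset; first by rewrite card_prod card_bool card_ord mul2n.
  by move=> [i j] [i' j'] [-> ->].
transitivity #|[set (None : pt5, j) | j : 'I_g.+1]|.
  congr #|pred_of_set _|; apply/setP=> -[[[c' i]|] j]; rewrite !inE /=.
    by apply/esym/imsetP => -[].
  by apply/esym/imsetP; exists j.
by rewrite card_imset ?cardsT ?card_ord // => j j' [].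
Qed.

(** A plex with [d = a - b] comes from a good group of order [a], or from the double of one of half
    that order. *)
Lemma two_cube a b : 0 < b -> b <= a -> a <= b.*2 ->
  exists (T : finType) (f : T -> T -> T -> T) (cls : T -> option bool),
    [/\ latin3 f, preserves cls f, forall c, #|[set x | cls x == Some c]| = a &
        #|[set x | cls x == None]| = b].
Proof.
move=> b0 leba leab; set d := a - b.
have led : d.*2 <= a by rewrite /d doubleB leq_subLR -addnn leq_add2r.
have -> : b = a - d by rewrite /d subKn.
have [|[G [lo [cG gG]]]|[G [lo [cG gG]]]] := @good_group_or_double a.
- exact: leq_trans leba.
- have [|h [A [cA Ah]]] := shiftable gG (e := d); first by rewrite cG.
  by have := group_plex gG Ah; rewrite cA => /plex_cube; apply.
have ledG : d <= #|G| by rewrite -leq_double cG.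
(* [A] and [A'] get sizes [uphalf d] and [d./2]; [A] needs room for a disjoint translate. *)
case: (leqP (uphalf d).*2 #|G|) => [leG|ltG].
  have [h [A [cA Ah]]] := shiftable gG leG.
  have [|A' sA cA'] := @subset_of_card _ A d./2; first by rewrite cA uphalf_half leq_addl.
  have := double_group_plex gG Ah sA; rewrite cA cA' uphalf_half -addnA addnn.
  rewrite odd_double_half => /plex_cube; apply=> //.
  by rewrite card_prod card_bool muln2.
(* Room is lacking only if [d] is odd and equal to [#|G|], that is, for [a] twice the order of the
   third block. *)
have eG : d = #|G|.
  apply/anti_leq; rewrite ledG -ltnS (leq_trans ltG) // uphalf_half doubleD.
  by rewrite -{3}[d]odd_double_half; case: odd.
have ea : a = d.*2 by rewrite eG cG.
have eb : a - d = d by rewrite ea -addnn addnK.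
rewrite eb ea; apply: inflated_cube5.
by rewrite -eb /d subKn.
Qed.

(** * Replacing a block by a cube of small blocks *)

Lemma stable_mem (T : finType) (X : {set T}) (g : T -> T) :
  injective g -> {in X, forall x, g x \in X} -> forall x, (g x \in X) = (x \in X).
Proof.
move=> gI gX x; apply/idP/idP => [gxX|]; last exact: gX.
by have [y [[yX /gI <-] _]] := inj_in_exists_unique gI gX gxX.
Qed.

Lemma card_bij (T S : finType) (D : {set T}) (s0 : S) : #|D| = #|S| ->
  exists (e : T -> S) (e' : S -> T),
    {in D, cancel e e'} /\ forall s, e' s \in D /\ e (e' s) = s.
Proof.
move=> cD; have [x0 x0D] : exists x0, x0 \in D.
  by apply/set0Pn; rewrite -card_gt0 cD; apply/card_gt0P; exists s0.
exists (fun x => enum_val (cast_ord cD (enum_rank_in x0D x))).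
exists (fun s => enum_val (cast_ord (esym cD) (enum_rank s))); split=> [x xD|s].
  by rewrite enum_valK cast_ordK enum_rankK_in.
by split; [apply: enum_valP | rewrite enum_valK_in cast_ordKV enum_rankK].
Qed.

(** A line with both fixed coordinates in [D] carries the symbols of [D] exactly on [D], so the
    array there may be exchanged for any latin cube on the same points. *)
Lemma refine (T K : finType) (f : T -> T -> T -> T) (cls : T -> option K) v b :
  0 < v -> 0 < b -> latin3 f -> preserves cls f ->
  #|[set x | cls x == None]| = v * b ->
  exists (f' : T -> T -> T -> T) (cls' : T -> K + 'I_v),
    [/\ latin3 f', preserves cls' f',
        forall k, #|[set x | cls' x == inl k]| = #|[set x | cls x == Some k]| &
        forall j, #|[set x | cls' x == inr j]| = b].
Proof.
case: v b => // v [] // b _ _ [f1 f2 f3] fcls; set D := [set x | _] => cD.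
have [|e [e' [eK e'P]]] := @card_bij _ ('I_v.+1 * 'I_b.+1)%type D (ord0, ord0).
  by rewrite cD card_prod !card_ord.
have e'I : injective e' by apply: (can_inj (fun s => (e'P s).2)).
have fD : {in D & &, forall x y z, f x y z \in D}.
  move=> x y z; rewrite !inE => /eqP xD /eqP yD /eqP zD.
  by rewrite fcls ?xD ?yD ?zD.
(* The minus sign makes the first component idempotent, [p - p + p = p], so each of its fibres is a
   subcube of order [b]. *)
pose g (p q r : 'I_v.+1 * 'I_b.+1) := ((p.1 - q.1 + r.1)%R, (p.2 + q.2 + r.2)%R).
pose f' x y z := if [&& x \in D, y \in D & z \in D] then e' (g (e x) (e y) (e z))
                 else f x y z.
pose cls' x : K + 'I_v.+1 := if cls x is Some k then inl k else inr (e x).1.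
have g1 q r : injective (fun p => g p q r).
  move=> [p p2] [p' p2'] E; have /= /GRing.addIr/GRing.addIr -> := congr1 fst E.
  by have /= /GRing.addIr/GRing.addIr -> := congr1 snd E.
have g2 p r : injective (fun q => g p q r).
  move=> [q q2] [q' q2'] E; have /= /GRing.addIr/GRing.addrI/GRing.oppr_inj -> := congr1 fst E.
  by have /= /GRing.addIr/GRing.addrI -> := congr1 snd E.
have g3 p q : injective (g p q).
  move=> [r r2] [r' r2'] E; have /= /GRing.addrI -> := congr1 fst E.
  by have /= /GRing.addrI -> := congr1 snd E.
have merge (X : bool) (h h' : T -> T) :
    injective h -> (X -> {in D, forall x, h x \in D}) ->
    {in D &, injective h'} -> (forall x, h' x \in D) ->
    injective (fun x => if X && (x \in D) then h' x else h x).
  move=> hI hD h'I h'D x y; case: X hD => [/(_ isT) hD|_] /=; last exact: hI.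
  have hE := stable_mem hI hD.
  case: ifP => xD; case: ifP => yD exy; [exact: h'I | | | exact: hI].
    by have := h'D x; rewrite exy hE yD.
  by have := h'D y; rewrite -exy hE xD.
have e'D s : e' s \in D by have [] := e'P s.
have eI : {in D &, injective e} by apply: can_in_inj eK.
exists f', cls'; split.
- split=> [y z|x z|x y].
  + have fE x : f' x y z = if ((y \in D) && (z \in D)) && (x \in D)
        then e' (g (e x) (e y) (e z)) else f x y z by rewrite /f' andbC.
    move=> x x'; rewrite !fE;
    apply: (@merge _ (fun x => f x y z)
      (fun x => e' (g (e x) (e y) (e z)))) => [|||x0] //.
      by move=> /andP[yD zD] x0 x0D; apply: fD.
    by move=> x0 x1 x0D x1D /e'I/g1/eI; apply.
  + have fE y : f' x y z = if ((x \in D) && (z \in D)) && (y \in D)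
        then e' (g (e x) (e y) (e z)) else f x y z by rewrite /f' andbAC andbA.
    move=> y y'; rewrite !fE;
    apply: (@merge _ (fun y => f x y z)
      (fun y => e' (g (e x) (e y) (e z)))) => [|||x0] //.
      by move=> /andP[xD zD] x0 x0D; apply: fD.
    by move=> x0 x1 x0D x1D /e'I/g2/eI; apply.
  have fE z : f' x y z = if ((x \in D) && (y \in D)) && (z \in D)
      then e' (g (e x) (e y) (e z)) else f x y z by rewrite /f' andbA.
  move=> z z'; rewrite !fE;
    apply: (@merge _ (fun z => f x y z)
      (fun z => e' (g (e x) (e y) (e z)))) => [|||x0] //.
    by move=> /andP[xD yD] x0 x0D; apply: fD.
  by move=> x0 x1 x0D x1D /e'I/g3/eI; apply.
- move=> x y z; rewrite /cls'.
  case cx: (cls x) => [k|]; case cy: (cls y) => [k'|] // [] e1; case cz: (cls z) => [k''|] // [] e2.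
    have -> : f' x y z = f x y z by rewrite /f' inE cx.
    by rewrite fcls ?cx ?cy ?cz ?e1 ?e2.
  rewrite /f' !inE cx cy cz /=; have := e'D (g (e x) (e y) (e z)).
  by rewrite inE => /eqP ->; rewrite (e'P _).2 /= e1 e2 GRing.subrr GRing.add0r.
- move=> k; congr #|pred_of_set _|; apply/setP=> x; rewrite !inE /cls'.
  by case: (cls x).
move=> j; have jI : injective (fun r => e' (j, r)) by move=> r r' /e'I [].
rewrite -[b.+1]card_ord -(card_imset _ jI); congr #|pred_of_set _|.
apply/setP=> x; rewrite !inE /cls'; apply/idP/imsetP => [|[r _ ->]].
  case cx: (cls x) => // /eqP[ej]; exists (e x).2 => //.
  by rewrite -ej -surjective_pairing eK // inE cx.
by have := e'D (j, r); rewrite inE => /eqP ->; rewrite (e'P _).2.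
Qed.

(** * Small blocks, and three or more large blocks *)

(** The level [None] is what the regular levels leave over, hence regular too. *)
Lemma composite_rest (T L : finType) (lev : T -> T -> option L) (r : L -> nat) :
  (forall l, regular (fun x y => lev x y == Some l) (r l)) ->
  exists f, latin3 f /\ forall x y z, lev z (f x y z) = lev x y.
Proof.
move=> reg; pose r' (o : option L) := if o is Some l then r l else #|T| - \sum_l r l.
have total (g : T -> option L) : (forall l, #|[set y | g y == Some l]| = r l) ->
    #|[set y | g y == None]| = #|T| - \sum_l r l.
  move=> gr; rewrite -[#|T|]sum1_card (partition_big g predT) //= (bigD1 None) //=.
  rewrite [X in _ + X](_ : _ = \sum_l r l); last first.
    rewrite (reindex_omap Some id) //=; last by case.
    rewrite (eq_bigl xpredT) => [|l]; last by rewrite /= eqxx.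
    by apply: eq_bigr => l _; rewrite -gr -sum1_card; apply: eq_bigl => y; rewrite inE.
  by rewrite addnK -sum1_card; apply: eq_bigl => y; rewrite inE.
apply: (@composite T (option L) lev r') => -[l|]; first exact: reg.
by split=> x; apply: total => l; [apply: (reg l).1 | apply: (reg l).2].
Qed.

Lemma regular_flip (T : finType) (E : rel T) r :
  regular E r -> regular (fun x y => E y x) r.
Proof. by case. Qed.

Lemma regular_all (T : finType) : regular (fun _ _ : T => true) #|T|.
Proof. by split=> x; rewrite -cardsT; congr #|pred_of_set _|; apply/setP=> y; rewrite !inE. Qed.

Lemma card_inl (T S : finType) (P : T + S -> bool) (D : pred T) :
  (forall x, P (inl x) = D x) -> (forall y, P (inr y) = false) ->
  #|[set z | P z]| = #|[set x | D x]|.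
Proof.
move=> PD PF; rewrite -(card_imset _ (@inl_inj T S)); congr #|pred_of_set _|.
apply/setP=> -[x|y]; rewrite !inE ?PD ?PF.
  by apply/idP/imsetP => [Dx|[x' + [->]]]; [exists x; rewrite ?inE | rewrite inE].
by apply/esym/imsetP => -[].
Qed.

Lemma card_inr (T S : finType) (P : T + S -> bool) (D : pred S) :
  (forall x, P (inl x) = false) -> (forall y, P (inr y) = D y) ->
  #|[set z | P z]| = #|[set y | D y]|.
Proof.
move=> PF PD; rewrite -(card_imset _ (@inr_inj T S)); congr #|pred_of_set _|.
apply/setP=> -[x|y]; rewrite !inE ?PD ?PF; last first.
  by apply/idP/imsetP => [Dx|[x' + [->]]]; [exists y; rewrite ?inE | rewrite inE].
by apply/esym/imsetP => -[].
Qed.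

Lemma card_fiber (T S : finType) (t : T) (D : pred S) :
  #|[set z : T * S | (z.1 == t) && D z.2]| = #|[set y | D y]|.
Proof.
have tI : injective (fun y : S => (t, y)) by move=> y y' [].
rewrite -(card_imset _ tI); congr #|pred_of_set _|.
apply/setP=> -[t' y]; rewrite inE /=.
apply/andP/imsetP => [[/eqP-> Dy]|[y' + [-> ->]]]; first by exists y; rewrite ?inE.
by rewrite inE.
Qed.

Lemma card_fiberT (T S : finType) (t : T) : #|[set z : T * S | z.1 == t]| = #|S|.
Proof.
have := card_fiber t (fun _ : S => true); rewrite cardsT => <-.
by congr #|pred_of_set _|; apply/setP=> z; rewrite !inE andbT.
Qed.

Section SmallBlocks.
Variables (u v a b : nat).
Hypothesis leba : b <= a.
Hypothesis leav : a <= v * b.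

Let S := ('I_v * 'I_b)%type.
Let T := ('I_u * 'I_a + S)%type.

(** [Some false] has degree [b] and [Some true] degree [a - b] in every row. From a point of a large
    block they reach exactly that block; from a point of a small block, [Some false] alone reaches
    exactly its block. This makes the blocks closed. *)
Let lev (E0 : rel 'I_a) (E1 : rel S) (x y : T) : option bool :=
  match x, y with
  | inl x, inl y => if y.1 == x.1 then Some (~~ E0 x.2 y.2) else None
  | inr x, inr y => if y.1 == x.1 then Some false else if E1 x y then Some true else None
  | _, _ => None
  end.

Let lev_flip E0 E1 x y :
  lev E0 E1 x y = lev (fun p q => E0 q p) (fun p q => E1 q p) y x.
Proof. by case: x y => [x|x] [y|y] //=; rewrite eq_sym. Qed.

Let lev_row E0 E1 : regular E0 b -> regular E1 (a - b) ->
  (forall x y, E1 x y -> x.1 != y.1) ->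
  forall c x, #|[set y | lev E0 E1 x y == Some c]| = if c then a - b else b.
Proof.
move=> reg0 [row1 _] off c; have [row0' _] := @regular_compl _ _ _ (a - b)
  (etrans (card_ord a) (esym (subnKC leba))) reg0.
have [row0 _] := reg0.
case=> x.
  rewrite (@card_inl _ _ _ (fun y => (y.1 == x.1) && (~~ E0 x.2 y.2 == c))) //=; last first.
    by move=> y; case: ifP.
  rewrite (card_fiber x.1 (fun q => ~~ E0 x.2 q == c)).
  case: c; [rewrite -(row0' x.2)|rewrite -(row0 x.2)];
  by congr #|pred_of_set _|; apply/setP=> q; rewrite !inE; case: (E0 _ _).
case: c.
  rewrite (@card_inr _ _ _ (E1 x)) //= => y.
  case: (E1 x y) (off x y) => [/(_ isT)|_]; last by case: ifP.
  by rewrite eq_sym => /negbTE ->.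
rewrite (@card_inr _ _ _ (fun y => y.1 == x.1)) //= => [|y]; last first.
  by case: ifP => // _; case: (E1 x y).
by rewrite card_fiberT card_ord.
Qed.

Lemma small_blocks : exists (f : T -> T -> T -> T) (cls : T -> 'I_u + 'I_v),
  [/\ latin3 f, preserves cls f,
      forall i, #|[set x | cls x == inl i]| = a &
      forall j, #|[set x | cls x == inr j]| = b].
Proof.
have [E0 [_ reg0]] : exists E0 : rel 'I_a, (forall x y, E0 x y -> true) /\ regular E0 b.
  by apply: regular_sub (regular_all 'I_a) _; rewrite card_ord.
(* Pairs in different small blocks form a regular graph of degree [v * b - b], and [a <= v * b]
   leaves room for degree [a - b]. *)
have [E1 [off reg1]] : exists E1 : rel S,
    (forall x y : S, E1 x y -> x.1 != y.1) /\ regular E1 (a - b).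
  have cS : #|{: S}| = b + (v * b - b).
    by rewrite subnKC ?card_prod ?card_ord // (leq_trans leba).
  apply: regular_sub (regular_compl cS _) (leq_sub2r b leav).
  have row (x : S) : #|[set y : S | y.1 == x.1]| = b by rewrite card_fiberT card_ord.
  split=> x; apply: etrans (row x); congr #|pred_of_set _|; apply/setP=> y; rewrite !inE //.
have [|f [latf levf]] := @composite_rest T _ (lev E0 E1) (fun c => if c then a - b else b).
  move=> c; split=> x; first exact: lev_row.
  rewrite -(@lev_row _ _ (regular_flip reg0) (regular_flip reg1) _ c x).
    by congr #|pred_of_set _|; apply/setP=> y; rewrite !inE lev_flip.
  by move=> p q /off; rewrite eq_sym.
pose cls (x : T) := match x with inl x => inl x.1 | inr x => inr x.1 end : 'I_u + 'I_v.
exists f, cls; split=> // [x y z|i|j].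
- move=> + /esym; have := levf x y z.
  case: (f x y z) => s; case: x y z => [x|x] [y|y] [z|z] //= + [e1] [e2];
    by rewrite ?e1 ?e2 ?eqxx //; case: eqP => [->|_] //; case: ifP.
- by rewrite (@card_inl _ _ _ (fun x => x.1 == i)) // card_fiberT card_ord.
by rewrite (@card_inr _ _ _ (fun x => x.1 == j)) // card_fiberT card_ord.
Qed.

End SmallBlocks.

(** * Inflated latin squares with a transversal *)

Section Transversals.
Import GRing.Theory.

Lemma derangement (U : finType) : 1 < #|U| ->
  exists d d' : U -> U, [/\ cancel d d', cancel d' d & forall x, d x != x].
Proof.
move=> cU; exists (fun x => enum_val (ordS (enum_rank x))).
exists (fun x => enum_val (ord_pred (enum_rank x))).
split=> x; rewrite ?enum_valK ?ordSK ?ord_predK ?enum_rankK //.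
apply/eqP=> /(canRL enum_valK)/(congr1 val) /=.
have := ltn_ord (enum_rank x); rewrite leq_eqVlt => /predU1P[ex|lt].
  by rewrite ex modnn => e0; move: ex cU; rewrite -e0 => <-.
by rewrite modn_small // => /eqP; rewrite eqn_leq ltnn.
Qed.

(* For even u, the group square of order u - 1 is prolonged along one of its
   difference classes. *)
Lemma latin_transversal u : 2 < u -> exists (U : finType) (M : U -> U -> U),
  #|U| = u /\ [/\ forall x, injective (M x), forall y, injective (M ^~ y) &
                  injective (fun x => M x x)].
Proof.
move=> u3; have [ou|eu] := boolP (odd u).
  have [G [lo [cG gG]]] := good_group_odd ou.
  exists G, (group_square lo); split=> //; split=> [x|y|x y].
  - exact: group_square_row.
  - exact: group_square_col.
  by rewrite /group_square !GRing.subrr => /GRing.addIr.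
case: u u3 eu => // u u2; rewrite /= negbK => /good_group_odd[G [lo [cG gG]]].
have [h h0] : exists h : G, h != 0%R.
  apply/existsP; rewrite -negb_forall; apply/negP=> /forallP G0.
  suff /fintype_le1P : forall x : G, all_equal_to x.
    by rewrite cG => le1; rewrite ltnS ltnNge le1 in u2.
  by move=> x y; rewrite (eqP (G0 x)) (eqP (G0 y)).
set M := group_square lo; have Mrow x : injective (M x) by exact: group_square_row.
have Mcol s : injective (M ^~ s) by exact: group_square_col.
(* Cells of difference [h] get the new symbol [None], and their old symbols move to the new column
   and row. The diagonal has difference [0], which is not [h], and stays a transversal. *)
exists (option G), (fun x s => match x, s with
  | Some x, Some s => if (s - x)%R == h then None else Some (M x s)
  | Some x, None => Some (M x (x + h)%R)
  | None, Some s => Some (M (s - h)%R s)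
  | None, None => None end).
have Mh x s : (s - x)%R != h -> M x s <> M x (x + h)%R.
  by move=> /eqP sx /Mrow e; apply: sx; rewrite e addrAC subrr add0r.
have hM x s : (s - x)%R != h -> M x s <> M (s - h)%R s.
  by move=> /eqP sx /Mcol e; apply: sx; rewrite e subKr.
have hrow s s' : M (s - h)%R s = M (s' - h)%R s' -> s = s'.
  by rewrite /M /group_square !subKr => /addIr/addIr.
have hcol x x' : M x (x + h)%R = M x' (x' + h)%R -> x = x'.
  by rewrite /M /group_square ![(_ + h)%R]addrC !addrK => /addIr.
split; first by rewrite card_option cG.
split=> [[x|] [s|] [s'|] //|[s|] [x|] [x'|] //|[x|] [x'|] //];
  rewrite ?subrr ?(eq_sym 0%R h) ?(negbTE h0) //.
- case: eqP => [e|_]; case: eqP => [e'|_] //; last by case=> /Mrow ->.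
  by move: e; rewrite -e' => /addIr->.
- by case: ifP => // /negbT/Mh sx [].
- by case: ifP => // /negbT/Mh sx [/esym].
- by case=> /hrow ->.
- case: eqP => [e|_]; case: eqP => [e'|_] //; last by case=> /Mcol ->.
  by move: e; rewrite -e' => /addrI/oppr_inj->.
- by case: ifP => // /negbT/hM sx [].
- by case: ifP => // /negbT/hM sx [/esym].
- by case=> /hcol ->.
by rewrite /M /group_square !subrr => -[/addIr->].
Qed.

End Transversals.

Lemma card_sum_set (T S : finType) (P : pred (T + S)) :
  #|[set z | P z]| = #|[set x | P (inl x)]| + #|[set y | P (inr y)]|.
Proof. by rewrite -!sum1dep_card big_sumType. Qed.

Section TransversalBlocks.
Variables (U : finType) (a b : nat).
Hypothesis leba : b <= a.

Let T := (U * 'I_a + 'I_b)%type.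

(** A prolongation of [L] inflated by [a]: in the cells [(i, pi i)] a [b]-regular part [E] is freed
    for [None], and the displaced levels fill the [b] new rows and columns. *)
Let lev (L : U -> U -> U) (pi pi' : U -> U) (E : rel 'I_a) (x y : T) : option U :=
  match x, y with
  | inl x, inl y => if (y.1 == pi x.1) && E x.2 y.2 then None else Some (L x.1 y.1)
  | inl x, inr _ => Some (L x.1 (pi x.1))
  | inr _, inl y => Some (L (pi' y.1) y.1)
  | inr _, inr _ => None
  end.

Let lev_flip L pi pi' E x y : cancel pi pi' -> cancel pi' pi ->
  lev L pi pi' E x y = lev (fun i j => L j i) pi' pi (fun p q => E q p) y x.
Proof.
move=> piK pi'K; case: x y => [x|x] [y|y] //=.
by rewrite -(can2_eq piK pi'K) eq_sym.
Qed.

Let lev_row L pi pi' E : (forall i, injective (L i)) -> injective (fun j => L (pi' j) j) ->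
  regular E b -> forall k x, #|[set y | lev L pi pi' E x y == Some k]| = a.
Proof.
move=> LI L'I regE k; have cE : #|'I_a| = b + (a - b) by rewrite card_ord subnKC.
have onto (g : U -> U) : injective g -> exists j0, forall j, (g j == k) = (j == j0).
  move=> gI; have [g' gK g'K] := injF_bij gI.
  by exists (g' k) => j; rewrite (can2_eq gK g'K).
case=> [[i p]|e]; rewrite card_sum_set /=.
  have [j0 Lk] := onto _ (LI i).
  rewrite [X in X + _](_ : _ = #|[set q | ~~ ((j0 == pi i) && E p q)]|); last first.
    rewrite -(card_fiber j0 (fun q => ~~ ((j0 == pi i) && E p q))).
    apply: eq_card => -[j q]; rewrite !inE /=.
    case: (eqVneq j j0) => [->|nj].
      by case: ifP => //= _; apply/eqP; congr Some; apply/eqP; rewrite Lk.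
    by case: ifP => //= _; rewrite [_ == _]Lk (negbTE nj).
  rewrite [X in _ + X](_ : _ = #|[set _ : 'I_b | pi i == j0]|); last first.
    by apply: eq_card => q; rewrite !inE [_ == _]Lk.
  rewrite eq_sym; case: eqP => _ /=.
    by rewrite cardsT card_ord (regular_compl cE regE).1 subnK.
  rewrite cardsT card_ord -[RHS]addn0; congr (_ + _).
  by apply: eq_card0 => q; rewrite inE.
have [j0 Lk] := onto _ L'I.
rewrite [X in _ + X](_ : _ = 0) ?addn0; last by apply: eq_card0 => q; rewrite !inE.
rewrite -[RHS]card_ord -(card_fiberT 'I_a j0).
by apply: eq_card => -[j q]; rewrite !inE [_ == _]Lk.
Qed.

Lemma transversal_blocks (M : U -> U -> U) :
  (forall i, injective (M i)) -> (forall j, injective (M ^~ j)) ->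
  injective (fun i => M i i) -> 1 < #|U| ->
  exists (f : T -> T -> T -> T) (cls : T -> option U),
  [/\ latin3 f, preserves cls f,
      forall i, #|[set x | cls x == Some i]| = a &
      #|[set x | cls x == None]| = b].
Proof.
move=> M1 M2 M3 /derangement[pi [pi' [piK pi'K pi_neq]]].
(* Permuting columns carries the diagonal transversal of [M] to the cells [(i, pi i)], off the
   diagonal, where the blocks are to sit. *)
pose L i j := M i (pi' j).
have LI i : injective (L i) by move=> j j' /M1/(can_inj pi'K).
have L'I j : injective (L ^~ j) by move=> i i' /M2.
have [E [_ regE]] : exists E : rel 'I_a, (forall x y, E x y -> true) /\ regular E b.
  by apply: regular_sub (regular_all 'I_a) _; rewrite card_ord.
have [|f [latf levf]] := @composite_rest T _ (lev L pi pi' E) (fun=> a).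
  move=> k; split=> x; first by apply: lev_row => // j j' /M3/(can_inj pi'K).
  have L'piI : injective (fun i => L i (pi i)) by move=> i i'; rewrite /L !piK => /M3.
  apply: etrans (@lev_row (fun i j => L j i) pi' pi _ L'I L'piI (regular_flip regE) k x).
  by apply: eq_card => y; rewrite !inE lev_flip.
pose cls (x : T) := if x is inl x then Some x.1 else None.
exists f, cls; split=> // [x y z|i|].
(* Block [i] has level [L i i], which its rows attain only inside the block, since [pi i != i]. *)
- move=> + /esym; have := levf x y z.
  have npi i : (i == pi i) = false by rewrite eq_sym (negbTE (pi_neq i)).
  case: (f x y z) => s; case: x y z => [x|x] [y|y] [z|z] //= + [e1] [e2];
    rewrite ?e1 ?e2 npi /=.
    by case: ifP => // _ [/LI->].
  by move=> [/LI/eqP]; rewrite (negbTE (pi_neq _)).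
- by rewrite (@card_inl _ _ _ (fun x => x.1 == i)) // card_fiberT card_ord.
by rewrite (@card_inr _ _ (fun x => cls x == None) xpredT) // cardsT card_ord.
Qed.

End TransversalBlocks.

(** * Assembling the constructions *)

Lemma realize_refined (u v a b : nat) (T K : finType) (f : T -> T -> T -> T)
    (cls : T -> option K) :
  0 < b -> 0 < u -> #|K| = u -> latin3 f -> preserves cls f ->
  (forall k, #|[set x | cls x == Some k]| = a) -> #|[set x | cls x == None]| = v * b ->
  exists_3RP (nseq u a ++ nseq v b).
Proof.
(* For [v = 0] no point has class [None]; [k0] is only a default making [odflt] total. *)
move=> b0 u0 cK latf fcls sza cN; case: (posnP v) => [v0|v0].
  move: cN; rewrite v0 => /cards0_eq N0; have [k0 _] : exists k0 : K, k0 \in K.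
    by apply/card_gt0P; rewrite cK.
  have clsE x : cls x = Some (odflt k0 (cls x)).
    by have := in_set0 x; rewrite -N0 inE; case: (cls x).
  pose cls' x : K + 'I_0 := inl (odflt k0 (cls x)).
  apply: (@realize_two _ _ _ _ _ _ _ f cls') => //; first exact: card_ord.
  - by move=> x y z [exy] [eyz]; rewrite /cls' fcls // clsE [RHS]clsE ?exy ?eyz.
  - move=> k; rewrite -(sza k); apply: eq_card => x; rewrite !inE (clsE x).
    by rewrite /cls' clsE.
  by case.
have [f' [cls' [latf' fcls' sz1 sz2]]] := refine v0 b0 latf fcls cN.
apply: (realize_two cK (card_ord v) latf' fcls') => // k.
by rewrite sz1.
Qed.

Lemma sufficiency k a b u : 2 < k -> 0 < b -> b < a -> 0 < u -> u <= k ->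
  [\/ 2 < u, u = 1 /\ a <= (k - 1) * b | u = 2 /\ a <= 2 * ((k - 2) * b)] ->
  exists_3RP (nseq u a ++ nseq (k - u) b).
Proof.
move=> k3 b0 ltba u0 leuk cond.
(* If the small blocks together reach [a], one construction serves all [u]. Otherwise, for [u] at
   least 2, they are first merged into one block of order [(k - u) * b]. *)
have [leav|ltva] := leqP a ((k - u) * b).
  have [f [cls [latf fcls sza szb]]] := small_blocks u (ltnW ltba) leav.
  exact: (realize_two (card_ord u) (card_ord (k - u)) latf fcls).
case: cond => [u3|[u1 le]|[u2 le]].
- have [U [M [cU [M1 M2 M3]]]] := latin_transversal u3.
  have [|f [cls [latf fcls sza szb]]] := transversal_blocks (ltnW ltva) M1 M2 M3.
    by rewrite cU ltnW.
  exact: (realize_refined b0 u0 cU latf fcls sza szb).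
- by rewrite u1 ltnNge le in ltva.
subst u; have [|||T [f [cls [latf fcls sza szb]]]] := @two_cube a ((k - 2) * b).
- by rewrite muln_gt0 subn_gt0 k3.
- exact: ltnW.
- by rewrite -mul2n.
by apply: (realize_refined b0 u0 _ latf fcls sza szb); rewrite card_bool.
Qed.

(** * Necessary conditions *)

Lemma latin_cube_latin3 n (C : array3 n) : latin_cube C -> latin3 C.
Proof.
case=> _ _ C1 C2 C3; split=> [y z x x'|x z y y'|x y z z'] e.
- have [x0 [_ uniq]] := C1 (C x y z) y z (in_setT _) (in_setT _) (in_setT _).
  by rewrite -(uniq x) ?(uniq x') ?inE.
- have [y0 [_ uniq]] := C2 (C x y z) x z (in_setT _) (in_setT _) (in_setT _).
  by rewrite -(uniq y) ?(uniq y') ?inE.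
have [z0 [_ uniq]] := C3 (C x y z) x y (in_setT _) (in_setT _) (in_setT _).
by rewrite -(uniq z) ?(uniq z') ?inE.
Qed.

Section Subcube.
Variables (n m : nat) (C : array3 n) (B : block n).
Hypothesis latC : latin3 C.
Hypothesis subB : subcube m C B.

(** A line that meets the subcube carries all its symbols inside it, hence none of them outside. *)
Lemma subcube_mem1 x y z : y \in coord2 B -> z \in coord3 B ->
  (C x y z \in symbols B) = (x \in coord1 B).
Proof.
move=> yB zB; case: subB latC => _ memB ex _ _ [C1 _ _].
apply/idP/idP => [sB|xB]; last exact: memB.
by have [x' [[x'B /C1 <-] _]] := ex _ _ _ sB yB zB.
Qed.

Lemma subcube_mem2 x y z : x \in coord1 B -> z \in coord3 B ->
  (C x y z \in symbols B) = (y \in coord2 B).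
Proof.
move=> xB zB; case: subB latC => _ memB _ ex _ [_ C2 _].
apply/idP/idP => [sB|yB]; last exact: memB.
by have [y' [[y'B /C2 <-] _]] := ex _ _ _ sB xB zB.
Qed.

Lemma subcube_mem3 x y z : x \in coord1 B -> y \in coord2 B ->
  (C x y z \in symbols B) = (z \in coord3 B).
Proof.
move=> xB yB; case: subB latC => _ memB _ _ ex [_ _ C3].
apply/idP/idP => [sB|zB]; last exact: memB.
by have [z' [[z'B /C3 <-] _]] := ex _ _ _ sB xB yB.
Qed.

(** For a layer [x] of the subcube and a layer [y] outside it, the [m] cells over [coord3 B] carry
    distinct symbols foreign to the subcube. *)
Lemma subcube_half : 0 < m -> m < n -> 2 * m <= n.
Proof.
case: (subB) => -[cX cY cZ cS] _ _ _ _ m0 ltmn.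
have [x xB] : exists x, x \in coord1 B by apply/set0Pn; rewrite -card_gt0 cX.
have [y yB] : exists y, y \in ~: coord2 B.
  by apply/set0Pn; rewrite -card_gt0 cardsCs setCK cY card_ord subn_gt0.
have [_ _ C3] := latC.
have : C x y @: coord3 B \subset ~: symbols B.
  apply/subsetP=> _ /imsetP[z zB ->].
  by rewrite inE subcube_mem2 //; rewrite inE in yB.
move=> /subset_leq_card; rewrite card_imset // cZ; have := cardsC (symbols B).
by rewrite cS card_ord => nE le; rewrite -[leqRHS]nE mul2n -addnn leq_add2l.
Qed.

End Subcube.

Lemma card_classes (T : finType) (P : pred T) (t : T -> nat) k :
  (forall x, t x < k) -> \sum_(i < k) #|[set x | P x && (t x == i)]| = #|[set x | P x]|.
Proof.
move=> tk; rewrite -[RHS]sum1dep_card (partition_big (fun x => Ordinal (tk x)) predT) //=.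
by apply: eq_bigr => i _; rewrite -sum1dep_card; apply: eq_bigl => x.
Qed.

(** * Counting the cells of a latin square by type *)

Section LatinSquareCount.
Variables (T : finType) (F : T -> T -> T) (k : nat) (ty tz ts : T -> nat).
Hypothesis F1 : forall z, injective (F ^~ z).
Hypothesis F2 : forall y, injective (F y).
Hypothesis tyk : forall y, ty y < k.
Hypothesis tzk : forall z, tz z < k.
Hypothesis tsk : forall s, ts s < k.

(** Any two of row, column and symbol determine the third, so summing over the type of any one of
    them gives a product of two class sizes. *)
Definition type_count i j l :=
  #|[set p | [&& ty p.1 == i, tz p.2 == j & ts (F p.1 p.2) == l]]|.

Lemma type_count_symbols i j :
  \sum_(l < k) type_count i j l = #|[set y | ty y == i]| * #|[set z | tz z == j]|.
Proof.
rewrite -cardsX -[RHS](@card_classes _ _ (fun p => ts (F p.1 p.2)) k) //.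
apply: eq_bigr => l _; apply: eq_card => p; rewrite !inE.
by rewrite -andbA.
Qed.

Lemma type_count_col i l :
  \sum_(j < k) type_count i j l = #|[set y | ty y == i]| * #|[set s | ts s == l]|.
Proof.
pose g (p : T * T) := (p.1, F p.1 p.2).
have gI : injective g by case=> y z [y' z'] [<-] /F2->.
rewrite -cardsX -(card_preimset _ gI) -[RHS](@card_classes _ _ (fun p => tz p.2) k) //.
apply: eq_bigr => j _; apply: eq_card => p; rewrite !inE.
by rewrite -andbA [_ && (tz _ == _)]andbC.
Qed.

Lemma type_count_row j l :
  \sum_(i < k) type_count i j l = #|[set z | tz z == j]| * #|[set s | ts s == l]|.
Proof.
pose g (p : T * T) := (p.2, F p.1 p.2).
have gI : injective g by case=> y z [y' z'] [<-] /F1->.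
rewrite -cardsX -(card_preimset _ gI) -[RHS](@card_classes _ _ (fun p => ty p.1) k) //.
by apply: eq_bigr => i _; apply: eq_card => p; rewrite !inE andbC.
Qed.

End LatinSquareCount.

Section TwoSubcubes.
Variables (n m r : nat) (C : array3 n) (B B' : block n).
Hypothesis latC : latin3 C.
Hypothesis subB : subcube m C B.
Hypothesis subB' : subcube m C B'.
Hypothesis disBB' : disjoint_blocks B B'.

Let ty (X X' : {set 'I_n}) y := if y \in X then 0 else if y \in X' then 1 else 2.

Let ty3 X X' y : ty X X' y < 3.
Proof. by rewrite /ty; case: ifP => _ //; case: ifP. Qed.

Let ty0 X X' y : (ty X X' y == 0) = (y \in X).
Proof. by rewrite /ty; case: ifP => _ //; case: ifP. Qed.

Let ty1 (X X' : {set 'I_n}) y : [disjoint X & X'] -> (ty X X' y == 1) = (y \in X').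
Proof.
by move=> dis; rewrite /ty; case: ifP => [/(disjointFr dis)->|_] //; case: ifP.
Qed.

Let card_ty (X X' : {set 'I_n}) : [disjoint X & X'] -> n = 2 * m + r -> #|X| = m -> #|X'| = m ->
  [/\ #|[set y | ty X X' y == 0]| = m, #|[set y | ty X X' y == 1]| = m &
      #|[set y | ty X X' y == 2]| = r].
Proof.
move=> dis nE cX cX'.
have e0 : #|[set y | ty X X' y == 0]| = m.
  by rewrite -cX; apply: eq_card => y; rewrite inE ty0.
have e1 : #|[set y | ty X X' y == 1]| = m.
  by rewrite -cX'; apply: eq_card => y; rewrite inE ty1.
split=> //; have := card_classes predT (ty3 X X').
rewrite big_ord_recr /= big_ord_recr /= big_ord_recr big_ord0 /= e0 e1 cardsT card_ord; lia.
Qed.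

(* Double counting in one layer x of B: the cells (y, z) are sorted according to
   where y, z and C x y z lie (in B, in B', in neither); N111 = 0 because x is
   outside B'. *)
Lemma two_subcubes_le : n = 2 * m + r -> 0 < m -> 0 < r -> m <= 2 * r.
Proof.
move=> nE m0 r0; have [[cX cY cZ cS] _ _ _ _] := subB; have [[cX' cY' cZ' cS'] _ _ _ _] := subB'.
case/and4P: (disBB') => dX dY dZ dS.
have [x xB] : exists x, x \in coord1 B by apply/set0Pn; rewrite -card_gt0 cX.
have xB' : x \notin coord1 B' by rewrite (disjointFr dX).
have [_ C2 C3] := latC.
pose ty_ := ty (coord2 B) (coord2 B'); pose tz_ := ty (coord3 B) (coord3 B').
pose ts_ := ty (symbols B) (symbols B'); pose N := type_count (C x) ty_ tz_ ts_.
have [y0 y1 y2] := card_ty dY nE cY cY'.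
have [z0 z1 z2] := card_ty dZ nE cZ cZ'.
have [s0 s1 s2] := card_ty dS nE cS cS'.
rewrite -/ty_ -/tz_ -/ts_ in y0 y1 y2 z0 z1 z2 s0 s1 s2.
have sum3 (g : nat -> nat) : \sum_(i < 3) g i = g 0 + g 1 + g 2.
  by rewrite 3!big_ord_recr big_ord0.
have S i j : N i j 0 + N i j 1 + N i j 2 = #|[set y | ty_ y == i]| * #|[set z | tz_ z == j]|.
  by rewrite -sum3 (type_count_symbols _ ty_ tz_ (ts := ts_)) // => s; apply: ty3.
have P i l : N i 0 l + N i 1 l + N i 2 l = #|[set y | ty_ y == i]| * #|[set s | ts_ s == l]|.
  by rewrite -(sum3 (fun j => N i j l)) (type_count_col _ _ (C3 x)) // => z; apply: ty3.
have R j l : N 0 j l + N 1 j l + N 2 j l = #|[set z | tz_ z == j]| * #|[set s | ts_ s == l]|.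
  by rewrite -(sum3 (fun i => N i j l)) (type_count_row _ _ (C2 x)) // => y; apply: ty3.
have N0 i j l : (forall y z, ty_ y == i -> tz_ z == j -> ts_ (C x y z) == l -> false) ->
    N i j l = 0.
  by move=> no; apply: eq_card0 => p; rewrite inE; apply/negbTE/and3P => -[h1 h2 /(no _ _ h1 h2)].
have N00 l : l != 0 -> N 0 0 l = 0.
  move=> l0; apply: N0 => y z; rewrite !ty0 => yB zB /eqP ls; move: l0.
  by rewrite -ls ty0 (subcube_mem3 latC subB) // zB.
have N0_0 j : j != 0 -> N 0 j 0 = 0.
  move=> j0; apply: N0 => y z; rewrite !ty0 => yB /eqP jz; move: j0.
  by rewrite -jz ty0 (subcube_mem3 latC subB) // => /negP.
have N_00 i : i != 0 -> N i 0 0 = 0.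
  move=> i0; apply: N0 => y z; rewrite !ty0 => /eqP iy zB; move: i0.
  by rewrite -iy ty0 (subcube_mem2 latC subB) // => /negP.
have N111 : N 1 1 1 = 0.
  apply: N0 => y z; rewrite /ty_ /tz_ /ts_ !ty1 // => yB zB.
  by rewrite (subcube_mem1 latC subB') // (negbTE xB').
have N001 := N00 1 isT; have N002 := N00 2 isT.
have N010 := N0_0 1 isT; have N020 := N0_0 2 isT.
have N100 := N_00 1 isT; have N200 := N_00 2 isT.
(* [N 2 2 0 = r * m - N 1 2 0] and [N 2 2 1 = r * m - N 1 2 1 - N 2 1 1] add up to at most [r * r].
   Any two of [N 1 2 0], [N 1 2 1], [N 2 1 1] sum to at most [r * m], because [N 2 1 0 = N 1 2 0]
   and [N 2 0 1 = N 1 2 1]; so the three sum to at most [3 * r * m / 2]. *)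
have le : r * m <= r * (2 * r).
  have [e1 e2 e3] := And3 (S 1 2) (S 2 1) (S 2 2).
  have [e4 e5 e6] := And3 (P 0 1) (P 1 0) (P 1 1).
  have [e7 e8 e9] := And3 (P 2 1) (R 0 1) (R 1 0).
  have [e10 e11 e12] := And3 (R 1 1) (R 2 0) (R 2 1).
  rewrite ?(y0, y1, y2, z0, z1, z2, s0, s1, s2, N001, N010, N020, N100, N200, N111)
    in e1 e2 e3 e4 e5 e6 e7 e8 e9 e10 e11 e12.
  move: e1 e2 e3 e4 e5 e6 e7 e8 e9 e10 e11 e12; clearbody N; clear; nia.
by rewrite leq_pmul2l in le.
Qed.

End TwoSubcubes.

Lemma necessity1 a b v : 0 < a -> 0 < b -> 0 < v ->
  exists_3RP (a :: nseq v b) -> a <= v * b.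
Proof.
move=> a0 b0 v0 [C [/latin_cube_latin3 latC [B [/(_ ord0) /= subB _]]]].
have n_eq : a + v * b = a + sumn (nseq v b) by rewrite sumn_nseq mulnC.
have := subcube_half latC subB a0; rewrite /= -n_eq mul2n -addnn leq_add2l; apply.
by rewrite -[ltnLHS]addn0 ltn_add2l muln_gt0 v0.
Qed.

Lemma necessity2 a b v : 0 < a -> 0 < b -> 0 < v ->
  exists_3RP [:: a, a & nseq v b] -> a <= 2 * (v * b).
Proof.
move=> a0 b0 v0 [C [/latin_cube_latin3 latC [B [subB disB]]]].
apply: (two_subcubes_le (m := a) latC (subB ord0) (subB (lift ord0 ord0))) => //.
- exact: disB.
- by rewrite /= sumn_nseq (mulnC b); lia.
by rewrite muln_gt0 v0.
Qed.

Theorem theorem1p11 (k a b u : nat) (hk : 3 <= k) (hb : 0 < b) (hab : b < a)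
    (hu1 : 1 <= u) (huk : u <= k)
    (hexc : ~ [/\ u = 2, a = 3 %[mod 6],
                  a < 2 * ((k - 2) * b) & 3 * ((k - 2) * b) < 2 * a]) :
  exists_3RP (nseq u a ++ nseq (k - u) b) <->
  [\/ 3 <= u,
      u = 1 /\ a <= (k - 1) * b
    | u = 2 /\ a <= 2 * ((k - 2) * b)].
Proof.
have a0 := ltn_trans hb hab.
split=> [|/(sufficiency hk hb hab hu1 huk) //].
case: u hu1 huk {hexc} => [|[|[|u]]] // _ _ ex; [apply: Or32|apply: Or33|exact: Or31].
  by split=> //; apply: necessity1 ex; rewrite // subn_gt0 ltnW.
by split=> //; apply: necessity2 ex; rewrite // subn_gt0.
Qed.
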